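(* Let $\mathfrak{g}$ be the two-dimensional complex Lie algebra with basis $\{a,b\}$ and bracket $[a,b]=b$, and let $\mathfrak{n}=\langle b\rangle$. (i) $\displaystyle \overline{\mathfrak{W}_{\mathfrak{n}}^{\mathfrak{g}}(0)}\cong\bigoplus_{\xi\in\mathbb{C}/\mathbb{Z}}\overline{\mathfrak{W}_{\mathfrak{n}}^{\mathfrak{g}}(0)}_{\xi}$. (ii) For each $\xi\in\mathbb{C}/\mathbb{Z}$ the category $\overline{\mathfrak{W}_{\mathfrak{n}}^{\mathfrak{g}}(0)}_{\xi}$ is equivalent to the category of finite dimensional modules over the quiver with vertex set $\mathbb{Z}$, with one loop $\mathtt{a}_i:i\to i$ at each vertex $i$ and one arrow $\mathtt{b}_i:i\to i+1$ for each $i\in\mathbb{Z}$ (and no other arrows), with relations $\mathtt{b}_i\mathtt{a}_i=\mathtt{a}_{i+1}\mathtt{b}_i$ for all $i$, where every $\mathtt{a}_i$ acts locally nilpotently.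
   Context: $\mathfrak{W}_{\mathfrak{n}}^{\mathfrak{g}}(0)$ is the category of $\mathfrak{g}$-modules on which $b$ acts locally nilpotently (equivalently: $\mathfrak{n}$ acts locally finitely and every composition factor of every finite dimensional $\mathfrak{n}$-submodule is the trivial $\mathfrak{n}$-module). $\overline{\mathfrak{W}_{\mathfrak{n}}^{\mathfrak{g}}(0)}$ is its full subcategory of modules of finite length. For $\mu\in\mathbb{C}$, $L(\mu)$ is the one-dimensional $\mathfrak{g}$-module with $b\cdot L(\mu)=0$ and $a\cdot v=\mu v$ for $v\in L(\mu)$. For a coset $\xi\in\mathbb{C}/\mathbb{Z}$, $\overline{\mathfrak{W}_{\mathfrak{n}}^{\mathfrak{g}}(0)}_{\xi}$ is the full subcategory of $\overline{\mathfrak{W}_{\mathfrak{n}}^{\mathfrak{g}}(0)}$ consisting of all modules whose simple subquotients have the form $L(\mu)$, $\mu\in\xi$. In relations, paths are composed from right to left; a finite dimensional module over the quiver is a representation of finite total dimension satisfying the relations. *)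

(* Defs.v *)
From HB Require Import structures.
From mathcomp Require Import all_boot all_order all_algebra.
From mathcomp Require Import ring.
From mathcomp Require Import boolp classical_sets functions cardinality.
From mathcomp Require Import reals complex.

Set Implicit Arguments.
Unset Strict Implicit.
Unset Printing Implicit Defensive.

Import GRing.Theory.
Local Open Scope ring_scope.
Local Open Scope classical_set_scope.

(* An alias, so that dependent functions can carry the pointwise K-module
   structure canonically. *)
Definition dprod (K : fieldType) (I : Type) (V : I -> lmodType K) : Type :=
  forall i, V i.

Section DProd.
Variables (K : fieldType) (I : Type) (V : I -> lmodType K).
Implicit Types f g : dprod V.

HB.instance Definition _ := gen_eqMixin (dprod V).
HB.instance Definition _ := gen_choiceMixin (dprod V).

Let add f g : dprod V := fun i => f i + g i.
Let opp f : dprod V := fun i => - f i.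
Let zero : dprod V := fun=> 0.
Let scale (c : K) f : dprod V := fun i => c *: f i.

Let addA : associative add.
Proof. by move=> f g h; apply: functional_extensionality_dep => i; exact: addrA. Qed.
Let addC : commutative add.
Proof. by move=> f g; apply: functional_extensionality_dep => i; exact: addrC. Qed.
Let add0 : left_id zero add.
Proof. by move=> f; apply: functional_extensionality_dep => i; exact: add0r. Qed.
Let addN : left_inverse zero opp add.
Proof. by move=> f; apply: functional_extensionality_dep => i; exact: addNr. Qed.

HB.instance Definition _ :=
  GRing.isZmodule.Build (dprod V) addA addC add0 addN.

Let scaleA c d f : scale c (scale d f) = scale (c * d) f.
Proof. by apply: functional_extensionality_dep => i; exact: scalerA. Qed.
Let scale1 : left_id 1 scale.
Proof. by move=> f; apply: functional_extensionality_dep => i; exact: scale1r. Qed.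
Let scaleDr : right_distributive scale +%R.
Proof. by move=> c f g; apply: functional_extensionality_dep => i; exact: scalerDr. Qed.
Let scaleDl f : {morph scale^~ f : c d / c + d}.
Proof. by move=> c d; apply: functional_extensionality_dep => i; exact: scalerDl. Qed.

HB.instance Definition _ := GRing.Zmodule_isLmodule.Build K (dprod V)
  scaleA scale1 scaleDr scaleDl.

Lemma dprodDE f g i : (f + g) i = f i + g i. Proof. by []. Qed.
Lemma dprodZE c f i : (c *: f) i = c *: f i. Proof. by []. Qed.
Lemma dprod0E i : (0 : dprod V) i = 0. Proof. by []. Qed.

End DProd.

(* All categories are K-linear: hom sets are K-modules and composition is
   bilinear. Functors, hence equivalences, are required to be K-linear. *)
Record category (K : fieldType) := Category {
  obj :> Type;
  hom : obj -> obj -> lmodType K;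
  idm : forall X, hom X X;
  comp : forall X Y Z, hom Y Z -> hom X Y -> hom X Z;
  comp_linl : forall X Y Z (f : hom X Y), linear (fun g : hom Y Z => comp g f);
  comp_linr : forall X Y Z (g : hom Y Z), linear (fun f : hom X Y => comp g f);
  compA : forall X Y Z T (h : hom Z T) (g : hom Y Z) (f : hom X Y),
    comp h (comp g f) = comp (comp h g) f;
  comp1m : forall X Y (f : hom X Y), comp (idm Y) f = f;
  compm1 : forall X Y (f : hom X Y), comp f (idm X) = f
}.
Arguments hom {K c} X Y.
Arguments idm {K c} X.
Arguments comp {K c X Y Z} g f.

Definition zero_obj (K : fieldType) (C : category K) (X : C) : Prop :=
  idm X = 0.

Definition is_iso (K : fieldType) (C : category K) (X Y : C) (f : hom X Y) :
  Prop := exists g : hom Y X, comp g f = idm X /\ comp f g = idm Y.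

Record functor (K : fieldType) (C D : category K) := Functor {
  fobj :> C -> D;
  fmap : forall X Y : C, hom X Y -> hom (fobj X) (fobj Y);
  fmap_linear : forall X Y, linear (@fmap X Y);
  fmap1 : forall X, fmap (idm X) = idm (fobj X);
  fmapM : forall (X Y Z : C) (g : hom Y Z) (f : hom X Y),
    fmap (comp g f) = comp (fmap g) (fmap f)
}.
Arguments fmap {K C D} F {X Y} f : rename.

Definition quasi_inverse (K : fieldType) (C D : category K)
    (F : functor C D) (G : functor D C) : Prop :=
  (exists eta : forall X : C, hom (G (F X)) X,
     (forall X, is_iso (eta X)) /\
     (forall (X Y : C) (f : hom X Y),
        comp f (eta X) = comp (eta Y) (fmap G (fmap F f)))) /\
  (exists eps : forall Y : D, hom (F (G Y)) Y,
     (forall Y, is_iso (eps Y)) /\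
     (forall (X Y : D) (f : hom X Y),
        comp f (eps X) = comp (eps Y) (fmap F (fmap G f)))).

Definition is_equivalence (K : fieldType) (C D : category K)
    (F : functor C D) : Prop :=
  exists G : functor D C, quasi_inverse F G.

Definition equivalent (K : fieldType) (C D : category K) : Prop :=
  exists F : functor C D, is_equivalence F.

Section FullSubcategory.
Variables (K : fieldType) (C : category K) (P : C -> Prop).

Definition full_subcategory : category K :=
  @Category K {X : C | P X} (fun X Y => hom (sval X) (sval Y))
    (fun X => idm (sval X)) (fun X Y Z g f => comp g f)
    (fun X Y Z f => comp_linl (Z := sval Z) f)
    (fun X Y Z g => comp_linr (X := sval X) g)
    (fun X Y Z T h g f => compA h g f)
    (fun X Y f => comp1m f) (fun X Y f => compm1 f).

End FullSubcategory.

Section DirectSumCategory.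
Variables (K : fieldType) (I : Type) (C : I -> category K).

Definition finitely_supported (X : forall i, C i) : Prop :=
  finite_set [set i | ~ zero_obj (X i)].

Let dobj := {X : forall i, C i | finitely_supported X}.
Let dhom (X Y : dobj) : lmodType K :=
  dprod (fun i => hom (sval X i) (sval Y i)).
Let did (X : dobj) : dhom X X := fun i => idm (sval X i).
Let dcomp (X Y Z : dobj) (g : dhom Y Z) (f : dhom X Y) : dhom X Z :=
  fun i => comp (g i) (f i).

Let dcomp_linl X Y Z f : linear (fun g : dhom Y Z => @dcomp X Y Z g f).
Proof.
move=> c g h; apply: functional_extensionality_dep => i; exact: comp_linl.
Qed.
Let dcomp_linr X Y Z g : linear (fun f : dhom X Y => @dcomp X Y Z g f).
Proof.
move=> c f h; apply: functional_extensionality_dep => i; exact: comp_linr.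
Qed.
Let dcompA X Y Z T (h : dhom Z T) (g : dhom Y Z) (f : dhom X Y) :
  dcomp h (dcomp g f) = dcomp (dcomp h g) f.
Proof. by apply: functional_extensionality_dep => i; exact: compA. Qed.
Let dcomp1m X Y (f : dhom X Y) : dcomp (did Y) f = f.
Proof. by apply: functional_extensionality_dep => i; exact: comp1m. Qed.
Let dcompm1 X Y (f : dhom X Y) : dcomp f (did X) = f.
Proof. by apply: functional_extensionality_dep => i; exact: compm1. Qed.

(* Objects: families (X_i)_i with X_i zero for all but finitely many i;
   morphisms: arbitrary families X_i -> Y_i. *)
Definition direct_sum_category : category K :=
  Category dcomp_linl dcomp_linr dcompA dcomp1m dcompm1.

End DirectSumCategory.

(* F is (up to isomorphism) the functor (X_i)_i |-> \bigoplus_i X_i from the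
   direct sum of full subcategories of C to C itself: the maps
   iota X i : X_i -> F X are natural in X and make F X a coproduct of the
   X_i in C. *)
Definition is_direct_sum_functor (K : fieldType) (C : category K) (I : Type)
    (P : I -> C -> Prop)
    (F : functor (direct_sum_category (fun i => full_subcategory (P i))) C) :
    Prop :=
  exists iota : forall (X : direct_sum_category (fun i => full_subcategory (P i)))
                       (i : I), hom (sval (sval X i)) (F X),
    (forall X Y (f : hom X Y) i,
       comp (fmap F f) (iota X i) = comp (iota Y i) (f i)) /\
    (forall X (Y : C) (h : forall i, hom (sval (sval X i)) Y),
       exists! u : hom (F X) Y, forall i, comp u (iota X i) = h i).

Record lie_algebra (K : fieldType) := LieAlgebra {
  lie_sort :> lmodType K;
  bracket : lie_sort -> lie_sort -> lie_sort;
  bracket_linl : forall y, linear (bracket^~ y);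
  bracket_linr : forall x, linear (bracket x);
  bracket_alt : forall x, bracket x x = 0;
  bracket_jacobi : forall x y z,
    bracket x (bracket y z) + bracket y (bracket z x) +
    bracket z (bracket x y) = 0
}.

Record lie_module (K : fieldType) (g : lie_algebra K) := LieModule {
  mod_sort :> lmodType K;
  act : g -> mod_sort -> mod_sort;
  act_linl : forall v, linear (act^~ v);
  act_linr : forall x, linear (act x);
  act_bracket : forall x y v,
    act (bracket x y) v = act x (act y v) - act y (act x v)
}.

Section LieModules.
Variables (K : fieldType) (g : lie_algebra K).
Implicit Types M N S : lie_module g.

Section Hom.
Variables M N : lie_module g.

Definition is_lie_hom (f : M -> N) : Prop :=
  linear f /\ forall (x : g) v, f (act x v) = act x (f v).

Definition lie_hom_pred : {pred M -> N} := fun f => `[< is_lie_hom f >].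

Lemma lie_hom_submod_closed : submod_closed lie_hom_pred.
Proof.
have act_lin x : linear (@act K g N x) by exact: act_linr.
split.
  apply/asboolP; split=> [c u v|x v]; first by rewrite /= scaler0 addr0.
  rewrite /GRing.zero /=; have := act_lin x (-1) 0 0.
  by rewrite scaler0 addr0 scaleN1r addNr.
move=> c f h /asboolP[fl fa] /asboolP[hl ha]; apply/asboolP; split.
  move=> d u v; rewrite !fctE fl hl !scalerDr !scalerA (mulrC c d).
  by rewrite addrACA.
by move=> x v; rewrite !fctE fa ha act_lin.
Qed.

HB.instance Definition _ :=
  GRing.isSubmodClosed.Build K (M -> N) lie_hom_pred lie_hom_submod_closed.

Record lie_hom := LieHom {
  lie_hom_fun :> M -> N;
  lie_homP : lie_hom_fun \in lie_hom_pred
}.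

HB.instance Definition _ := [isSub for lie_hom_fun].
HB.instance Definition _ := [Choice of lie_hom by <:].
HB.instance Definition _ := [SubChoice_isSubLmodule of lie_hom by <:].

Lemma lie_hom_linear (f : lie_hom) : linear f.
Proof. by case: (asboolW (lie_homP f)). Qed.

Lemma lie_hom_act (f : lie_hom) (x : g) v : f (act x v) = act x (f v).
Proof. by case: (asboolW (lie_homP f)) => _; exact. Qed.

Lemma lie_hom_ext (f h : lie_hom) : f =1 h -> f = h.
Proof. by move=> fh; apply: val_inj; exact: funext. Qed.

End Hom.

Lemma lie_id_subproof M : (id : M -> M) \in @lie_hom_pred M M.
Proof. by apply/asboolP. Qed.

Lemma lie_comp_subproof M N S (h : lie_hom N S) (f : lie_hom M N) :
  (h \o f : M -> S) \in @lie_hom_pred M S.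
Proof.
apply/asboolP; split=> [c u v|x v] /=.
  by rewrite !lie_hom_linear.
by rewrite !lie_hom_act.
Qed.

Definition lie_id M := LieHom (lie_id_subproof M).
Definition lie_comp M N S (h : lie_hom N S) (f : lie_hom M N) :=
  LieHom (lie_comp_subproof h f).

Lemma lie_comp_linl M N S (f : lie_hom M N) :
  linear (fun h : lie_hom N S => lie_comp h f).
Proof. by move=> c h k; apply: lie_hom_ext. Qed.

Lemma lie_comp_linr M N S (h : lie_hom N S) :
  linear (fun f : lie_hom M N => lie_comp h f).
Proof. by move=> c f k; apply: lie_hom_ext => v /=; exact: lie_hom_linear. Qed.

Lemma lie_compA M N S T (k : lie_hom S T) (h : lie_hom N S) (f : lie_hom M N) :
  lie_comp k (lie_comp h f) = lie_comp (lie_comp k h) f.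
Proof. exact: lie_hom_ext. Qed.

Lemma lie_comp1m M N (f : lie_hom M N) : lie_comp (lie_id N) f = f.
Proof. exact: lie_hom_ext. Qed.

Lemma lie_compm1 M N (f : lie_hom M N) : lie_comp f (lie_id M) = f.
Proof. exact: lie_hom_ext. Qed.

Definition lie_module_category : category K :=
  @Category K (lie_module g) lie_hom lie_id lie_comp
    lie_comp_linl lie_comp_linr lie_compA lie_comp1m lie_compm1.

Definition is_submodule M (N : set M) : Prop :=
  [/\ N 0, forall (c : K) u v, N u -> N v -> N (c *: u + v)
    & forall (x : g) v, N v -> N (act x v)].

Definition zero_module M : Prop := forall v : M, v = 0.

Definition simple_module M : Prop :=
  ~ zero_module M /\
  forall N : set M, is_submodule N -> N = [set 0] \/ N = setT.

Definition injective_hom M N (f : lie_hom M N) : Prop := injective f.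
Definition surjective_hom M N (f : lie_hom M N) : Prop :=
  forall w, exists v, f v = w.

Definition isomorphic M N : Prop :=
  exists f : lie_hom M N, bijective f.

Definition short_exact N M S (i : lie_hom N M) (p : lie_hom M S) : Prop :=
  [/\ injective_hom i, surjective_hom p
    & forall v, p v = 0 <-> exists w, i w = v].

(* Existence of a composition series 0 = M_0 < M_1 < ... < M_n = M with simple
   quotients, built one step at a time; submodules and quotients are taken up
   to isomorphism. *)
Inductive finite_length : lie_module g -> Prop :=
| finite_length0 M : zero_module M -> finite_length M
| finite_lengthS N M S (i : lie_hom N M) (p : lie_hom M S) :
    short_exact i p -> finite_length N -> simple_module S -> finite_length M.

(* S is a quotient of a submodule of M, up to isomorphism. *)
Definition subquotient S M : Prop :=
  exists (N : lie_module g) (i : lie_hom N M) (p : lie_hom N S),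
    injective_hom i /\ surjective_hom p.

Definition locally_nilpotent (V : Type) (zero : V) (f : V -> V) : Prop :=
  forall v, exists n, iter n f v = zero.

End LieModules.

Section TheLieAlgebra.
Variable K : fieldType.

(* (s, t) stands for s a + t b, where [a, b] = b. *)
Let g0 : lmodType K := (K^o * K^o)%type.

Definition g_bracket (x y : g0) : g0 := (0, x.1 * y.2 - x.2 * y.1).

Lemma g_bracket_linl y : linear (g_bracket^~ y).
Proof.
move=> c x z; congr pair; rewrite /= /GRing.scale /=; first by rewrite mulr0 addr0.
by rewrite !mulrDl; ring.
Qed.

Lemma g_bracket_linr x : linear (g_bracket x).
Proof.
move=> c y z; congr pair; rewrite /= /GRing.scale /=; first by rewrite mulr0 addr0.
by ring.
Qed.

Lemma g_bracket_alt x : g_bracket x x = 0.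
Proof. by congr pair => /=; ring. Qed.

Lemma g_bracket_jacobi x y z :
  g_bracket x (g_bracket y z) + g_bracket y (g_bracket z x) +
  g_bracket z (g_bracket x y) = 0.
Proof. by congr pair => /=; ring. Qed.

Definition g_alg : lie_algebra K :=
  LieAlgebra g_bracket_linl g_bracket_linr g_bracket_alt g_bracket_jacobi.

Definition ga : g_alg := (1, 0).
Definition gb : g_alg := (0, 1).

Lemma g_basis (x : g_alg) : x = x.1 *: ga + x.2 *: gb.
Proof.
by case: x => s t; congr pair; rewrite /= /GRing.scale /= !(mulr0, mulr1, addr0, add0r).
Qed.

Lemma g_bracket_ab : bracket ga gb = gb.
Proof. by congr pair => /=; ring. Qed.

Let L_act (mu : K) (x : g_alg) (v : K^o) : K^o := (x.1 * mu) *: v.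

Let L_act_linl mu v : linear ((L_act mu)^~ v).
Proof. by move=> c x y; rewrite /L_act /= /GRing.scale /=; ring. Qed.

Let L_act_linr mu x : linear (L_act mu x).
Proof. by move=> c x' y; rewrite /L_act /= /GRing.scale /=; ring. Qed.

Let L_act_bracket mu x y v :
  L_act mu (bracket x y) v = L_act mu x (L_act mu y v) - L_act mu y (L_act mu x v).
Proof. by rewrite /L_act /= /GRing.scale /=; ring. Qed.

Definition L (mu : K) : lie_module g_alg :=
  LieModule (L_act_linl mu) (L_act_linr mu) (L_act_bracket mu).

Lemma L_a mu v : act ga v = mu *: v :> L mu.
Proof. by rewrite /= /L_act mul1r. Qed.

Lemma L_b mu v : act gb v = 0 :> L mu.
Proof. by rewrite /= /L_act mul0r scale0r. Qed.

(* The Lie subalgebra n is spanned by b = gb. *)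
Definition W0 : category K :=
  @full_subcategory K (lie_module_category g_alg)
    (fun M : lie_module g_alg => locally_nilpotent 0 (@act K g_alg M gb)).

Definition W0bar : category K :=
  @full_subcategory K W0 (fun M => finite_length (sval M)).

(* Elements of K / Z, as subsets of K. *)
Definition coset : Type :=
  {xi : set K | exists lam : K, xi = [set mu | exists n : int, mu = lam + n%:~R]}.

Definition in_block (xi : coset) (M : W0bar) : Prop :=
  forall S : lie_module g_alg,
    simple_module S -> subquotient S (sval (sval M)) ->
    exists2 mu, sval xi mu & isomorphic S (L mu).

Definition W0bar_block (xi : coset) : category K :=
  full_subcategory (in_block xi).

End TheLieAlgebra.

Section QuiverReps.
Variable K : fieldType.

(* Finite total dimension: every qspace i is finite dimensional (vectType) and
   only finitely many are nonzero. *)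
Record qrep := QRep {
  qspace :> int -> vectType K;
  qa : forall i, 'End(qspace i);
  qb : forall i, 'Hom(qspace i, qspace (i + 1));
  qrel : forall i, (qb i \o qa i = qa (i + 1) \o qb i)%VF;
  qfin : finite_set [set i | \dim {:qspace i} != 0%N];
  qnil : forall i, locally_nilpotent 0 (qa i)
}.

Section Hom.
Variables V W : qrep.

Definition is_qhom (f : dprod (fun i => 'Hom(V i, W i) : lmodType K)) : Prop :=
  (forall i, (f i \o qa V i = qa W i \o f i)%VF) /\
  (forall i, (f (i + 1) \o qb V i = qb W i \o f i)%VF).

Definition qhom_pred : {pred dprod (fun i => 'Hom(V i, W i) : lmodType K)} :=
  fun f => `[< is_qhom f >].

Lemma qhom_submod_closed : submod_closed qhom_pred.
Proof.
split.
  by apply/asboolP; split=> i; rewrite dprod0E comp_lfun0l comp_lfun0r.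
move=> c f h /asboolP[fa fb] /asboolP[ha hb]; apply/asboolP; split=> i.
  by rewrite !dprodDE !dprodZE comp_lfunDl comp_lfunDr -comp_lfunZl -comp_lfunZr fa ha.
by rewrite !dprodDE !dprodZE comp_lfunDl comp_lfunDr -comp_lfunZl -comp_lfunZr fb hb.
Qed.

HB.instance Definition _ :=
  GRing.isSubmodClosed.Build K _ qhom_pred qhom_submod_closed.

Record qhom := QHom {
  qhom_fun : dprod (fun i => 'Hom(V i, W i) : lmodType K);
  qhomP : qhom_fun \in qhom_pred
}.

HB.instance Definition _ := [isSub for qhom_fun].
HB.instance Definition _ := [Choice of qhom by <:].
HB.instance Definition _ := [SubChoice_isSubLmodule of qhom by <:].

Definition qhom_at (f : qhom) : forall i, 'Hom(V i, W i) := qhom_fun f.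
Coercion qhom_at : qhom >-> Funclass.

Lemma qhom_a (f : qhom) i : (f i \o qa V i = qa W i \o f i)%VF.
Proof. by case: (asboolW (qhomP f)) => + _; apply. Qed.

Lemma qhom_b (f : qhom) i : (f (i + 1) \o qb V i = qb W i \o f i)%VF.
Proof. by case: (asboolW (qhomP f)) => _; apply. Qed.

Lemma qhom_ext (f h : qhom) : (forall i, f i = h i) -> f = h.
Proof. by move=> fh; apply: val_inj; exact: functional_extensionality_dep. Qed.

End Hom.

Lemma qid_subproof (V : qrep) :
  ((fun i => \1%VF) : dprod (fun i => 'Hom(V i, V i) : lmodType K))
    \in @qhom_pred V V.
Proof.
by apply/asboolP; split=> i; rewrite comp_lfun1l comp_lfun1r.
Qed.

Lemma qcomp_subproof (U V W : qrep) (h : qhom V W) (f : qhom U V) :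
  ((fun i => (h i \o f i)%VF) : dprod (fun i => 'Hom(U i, W i) : lmodType K))
    \in @qhom_pred U W.
Proof.
apply/asboolP; split=> i.
  by rewrite -comp_lfunA qhom_a comp_lfunA qhom_a comp_lfunA.
by rewrite -comp_lfunA qhom_b comp_lfunA qhom_b comp_lfunA.
Qed.

Definition qid V := QHom (qid_subproof V).
Definition qcomp U V W (h : qhom V W) (f : qhom U V) :=
  QHom (qcomp_subproof h f).

Lemma qcomp_linl U V W (f : qhom U V) : linear (fun h : qhom V W => qcomp h f).
Proof.
by move=> c h k; apply: qhom_ext => i /=; rewrite comp_lfunDl -comp_lfunZl.
Qed.

Lemma qcomp_linr U V W (h : qhom V W) : linear (fun f : qhom U V => qcomp h f).
Proof.
by move=> c f k; apply: qhom_ext => i /=; rewrite comp_lfunDr -comp_lfunZr.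
Qed.

Lemma qcompA U V W X (k : qhom W X) (h : qhom V W) (f : qhom U V) :
  qcomp k (qcomp h f) = qcomp (qcomp k h) f.
Proof. by apply: qhom_ext => i /=; rewrite comp_lfunA. Qed.

Lemma qcomp1m V W (f : qhom V W) : qcomp (qid W) f = f.
Proof. by apply: qhom_ext => i /=; rewrite comp_lfun1l. Qed.

Lemma qcompm1 V W (f : qhom V W) : qcomp f (qid V) = f.
Proof. by apply: qhom_ext => i /=; rewrite comp_lfun1r. Qed.

Definition qrep_category : category K :=
  @Category K qrep qhom qid qcomp qcomp_linl qcomp_linr qcompA qcomp1m qcompm1.

End QuiverReps.

(* Main.v *)
(* Write [A], [B] for the actions of [a], [b], so that [A B = B (A + 1)]; hence
   [B] maps the generalized [x]-eigenspace of [A] to the one for [x + 1].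
   A simple module with [B] locally nilpotent is some [L mu]: [ker B] is a
   nonzero submodule, so [B = 0], and [A] has an eigenvector.  Along a
   composition series it follows that a module of finite length is finite
   dimensional and killed by a product of factors [A - x], so that it is the
   direct sum of its generalized eigenspaces.  Conversely, a finite dimensional
   module on which [B] is locally nilpotent has finite length, because [A] and
   [B] have a common eigenvector in the dual space.
   (i) Grouping the eigenvalues modulo [Z] decomposes every module into its
   block components, and there are no morphisms between distinct blocks.
   (ii) In the block of [lam + Z], a module is the family of the generalized
   [(lam + i)]-eigenspaces, with [A - (lam + i)] as loop and [B] as arrow; all
   of it is recovered from the total space of the corresponding representation.
   Both functors are fully faithful and essentially surjective. *)
From HB Require Import structures.
From mathcomp Require Import all_boot all_order all_algebra.
From mathcomp Require Import ring zify.
From mathcomp Require Import boolp classical_sets functions cardinality.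
From mathcomp Require Import reals complex.
Require Import Defs.

Set Implicit Arguments.
Unset Strict Implicit.
Unset Printing Implicit Defensive.

Import GRing.Theory.
Local Open Scope ring_scope.
Local Open Scope classical_set_scope.

(** * Linearity of Lie actions and of module morphisms *)

Definition linear_of (K : fieldType) (U V : lmodType K) (f : U -> V)
    (fl : linear f) : {linear U -> V} :=
  HB.pack f (GRing.isLinear.Build K U V _ f fl).

HB.instance Definition _ (K : fieldType) (g : lie_algebra K)
    (M : lie_module g) (x : g) :=
  GRing.isLinear.Build K M M _ (@act K g M x) (@act_linr K g M x).

HB.instance Definition _ (K : fieldType) (g : lie_algebra K)
    (M N : lie_module g) (f : lie_hom M N) :=
  GRing.isLinear.Build K M N _ (lie_hom_fun f) (lie_hom_linear f).

(** * Products of factors [T - x] of an operator *)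

Section Shifts.
Variable K : fieldType.
Implicit Types (D E : set K) (r s : seq K) (x y : K).

Section OneOperator.
Variables (M : lmodType K) (T : {linear M -> M}).
Implicit Types v w : M.

(** The value at [v] of the split polynomial in [T] with list of roots [r]. Working with root lists
    makes concatenation the product and needs no finite dimension. *)
Definition shifts r v : M := foldr (fun x w => T w - x *: w) v r.

Lemma shifts_linear r : linear (shifts r).
Proof.
elim: r => [|x r IH] c u v //=; rewrite IH linearP scalerDr opprD addrACA.
by rewrite scalerBr !scalerA (mulrC x).
Qed.

HB.instance Definition _ r := GRing.isLinear.Build K M M _ _ (shifts_linear r).

Lemma shifts_cat r s v : shifts (r ++ s) v = shifts r (shifts s v).
Proof. by rewrite /shifts foldr_cat. Qed.

Lemma shifts_shift r x v : shifts r (T v - x *: v) = T (shifts r v) - x *: shifts r v.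
Proof.
elim: r => [|y r IH] //=; rewrite IH !(linearB T) !(linearZZ T) !scalerBr !opprB.
by rewrite !scalerA (mulrC y) [LHS]addrACA [RHS]addrACA; congr (_ + _); rewrite addrC.
Qed.

Lemma shiftsC r s v : shifts r (shifts s v) = shifts s (shifts r v).
Proof. by elim: s => [|x s IH] //=; rewrite shifts_shift IH. Qed.

Lemma shifts_eigen r x v : T v = x *: v ->
  shifts r v = (\prod_(y <- r) (x - y)) *: v.
Proof.
move=> Tv; elim: r => [|y r IH] /=; first by rewrite big_nil scale1r.
rewrite IH linearZ /= Tv big_cons !scalerA -scalerBl; congr (_ *: _).
by ring.
Qed.

Lemma shifts_eigen_mem r x v : v != 0 -> T v = x *: v -> shifts r v = 0 -> x \in r.
Proof.
move=> v0 /(shifts_eigen r) -> /eqP; rewrite scaler_eq0 (negbTE v0) orbF.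
by rewrite prodf_seq_eq0 => /hasP[y yr]; rewrite subr_eq0 => /eqP ->.
Qed.

(** Induction on [r]: for the head [x], a nonzero [shifts r v] would be an eigenvector for [x] that
    is still killed by [shifts s], which forces [x] into [s]. *)
Lemma shifts_coprime r s v : shifts r v = 0 -> shifts s v = 0 ->
  (forall x, x \in r -> x \notin s) -> v = 0.
Proof.
elim: r => [|x r IH] //= rv sv rs; apply: IH => //; last first.
  by move=> y yr; apply: rs; rewrite inE yr orbT.
have [//|w0] := eqVneq (shifts r v) 0.
have /negP[] := rs x (mem_head _ _).
apply: (shifts_eigen_mem w0); first by apply/eqP; rewrite -subr_eq0 rv.
by rewrite shiftsC sv linear0.
Qed.

(** Induction on the list: [T - x] and [T - y] differ by the nonzero scalar [y - x], so a preimage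
    [z] of [(T - y) v] under [T - x] yields the preimage [(y - x)^-1 (v - z)] of [v]. *)
Lemma shifts_divide r x v : shifts r v = 0 -> x \notin r ->
  exists2 w, shifts r w = 0 & T w - x *: w = v.
Proof.
elim: r v => [|y r IH] v /= rv; first by exists 0; rewrite // linear0 scaler0 subr0.
rewrite inE negb_or => /andP[xy xr].
have [|z rz zE] := IH (T v - y *: v) _ xr; first by rewrite shifts_shift.
have yx0 : y - x != 0 by rewrite subr_eq0 eq_sym.
exists ((y - x)^-1 *: (v - z)).
  by rewrite -[LHS]/(shifts (y :: r) _) linearZ linearB /= rv rz linear0 !scaler0 !subr0 scaler0.
rewrite -[LHS]/(shifts [:: x] _) linearZ linearB /= zE.
have -> : T v - x *: v - (T v - y *: v) = (y - x) *: v.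
  by rewrite opprB addrC addrA subrK scalerBl.
by rewrite scalerA mulVf ?scale1r.
Qed.

(** The sum of the generalized eigenspaces of [T] for the eigenvalues in [D], phrased by
    annihilating lists so that it makes sense in any dimension. *)
Definition gspace D v : Prop := exists2 r, {in r, forall x, D x} & shifts r v = 0.

Lemma gspace0 D : gspace D 0.
Proof. by exists [::]. Qed.

Lemma gspace_lin D c u v : gspace D u -> gspace D v -> gspace D (c *: u + v).
Proof.
move=> [r rD ru] [s sD sv]; exists (r ++ s); last first.
  by rewrite linearP /= !shifts_cat sv linear0 addr0 shiftsC ru linear0 scaler0.
by move=> x; rewrite mem_cat => /orP[/rD|/sD].
Qed.

Lemma gspaceD D u v : gspace D u -> gspace D v -> gspace D (u + v).
Proof. by move=> uD vD; rewrite -[u]scale1r; exact: gspace_lin. Qed.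

Lemma gspaceN D v : gspace D v -> gspace D (- v).
Proof.
move=> vD; rewrite -scaleN1r -[X in gspace _ X]addr0.
by apply: gspace_lin => //; exact: gspace0.
Qed.

Lemma gspace_sum D (I : Type) (s : seq I) (P : pred I) (F : I -> M) :
  (forall i, P i -> gspace D (F i)) -> gspace D (\sum_(i <- s | P i) F i).
Proof. by move=> FD; apply: big_ind => //; [exact: gspace0|exact: gspaceD]. Qed.

Lemma gspaceS D E v : D `<=` E -> gspace D v -> gspace E v.
Proof. by move=> DE [r rD rv]; exists r => // x /rD /DE. Qed.

Lemma gspace_disjoint D E v : (forall x, D x -> ~ E x) ->
  gspace D v -> gspace E v -> v = 0.
Proof.
move=> DE [r rD rv] [s sE sv]; apply: (shifts_coprime rv sv) => x /rD /DE nE.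
by apply/negP => /sE.
Qed.

Lemma gspace_eigen D x v : T v = x *: v -> gspace D v -> v != 0 -> D x.
Proof. by move=> Tv [r rD rv] v0; apply: rD; exact: shifts_eigen_mem rv. Qed.

Section Decomposition.
Variables (I : Type) (C : I -> set K).
Hypothesis C_disj : forall i j x, C i x -> C j x -> i = j.

(** The sum of the subspaces [gspace (C i)]; the inductive form avoids carrying finite index
    sets. *)
Inductive gsum : M -> Prop :=
| gsum0 : gsum 0
| gsumD i u v : gspace (C i) u -> gsum v -> gsum (u + v).

(** On every summand other than that of [x] the operator [T - x] is onto by [shifts_divide], because
    disjointness keeps [x] out of the other sets [C j]. Only the part in [C i] is left over. *)
Let gsum_divide i x v : C i x -> gsum v ->
  exists w z, [/\ gspace (C i) w, gsum z & v = w + (T z - x *: z)].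
Proof.
move=> Cix; elim=> [|j u w ju _ [y [z [iy gz ->]]]].
  exists 0, 0; split; [exact: gspace0|exact: gsum0|].
  by rewrite linear0 scaler0 subr0 addr0.
have [ij|ij] := pselect (i = j).
  exists (u + y), z; split=> //; last by rewrite addrA.
  by apply: gspaceD => //; rewrite ij.
case: ju => r rj ru; have [|u' ru' <-] := @shifts_divide r x u ru.
  by apply/negP => /rj /(C_disj Cix).
exists y, (u' + z); split=> //; first by apply: (gsumD (i := j)) => //; exists r.
by rewrite linearD scalerDr opprD addrCA; congr (_ + _); rewrite addrACA.
Qed.

(* Induction on the annihilating list: by [gsum_divide], [v] can be corrected by
   some [z] in the sum so that [(T - x) (v - z)] lies in the summand of [x]. *)
Lemma gspace_gsum v : gspace [set x | exists i, C i x] v -> gsum v.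
Proof.
move=> [r]; elim: r v => [|x r IH] v rC; first by rewrite /= => ->; exact: gsum0.
rewrite -[shifts _ _]/(T (shifts r v) - x *: shifts r v) -shifts_shift => rv.
have gTv : gsum (T v - x *: v).
  by apply: IH rv => y yr; apply: rC; rewrite inE yr orbT.
have [i Cix] := rC _ (mem_head x r).
have [y [z [iy gz vE]]] := gsum_divide Cix gTv.
rewrite -[v](subrK z); apply: (gsumD (i := i)) => //.
(* The last entry of a list acts first: [T - x] sends [v - z] to [y], which [s] kills. *)
case: iy => s si sy; exists (rcons s x).
  by move=> u; rewrite mem_rcons inE => /orP[/eqP ->|/si].
rewrite -cats1 shifts_cat /=.
have -> // : T (v - z) - x *: (v - z) = y.
by rewrite -[LHS]/(shifts [:: x] (v - z)) linearB /= vE addrK.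
Qed.

End Decomposition.
End OneOperator.
End Shifts.

Section ShiftsMorphism.
Variables (K : fieldType) (M N : lmodType K).
Variables (T : {linear M -> M}) (T' : {linear N -> N}) (f : {linear M -> N}).

Lemma shifts_morph r v : (forall v, f (T v) = T' (f v)) ->
  f (shifts T r v) = shifts T' r (f v).
Proof. by move=> fT; elim: r => [|x r IH] //=; rewrite linearB linearZ /= fT IH. Qed.

Lemma gspace_morph D v : (forall v, f (T v) = T' (f v)) ->
  gspace T D v -> gspace T' D (f v).
Proof. by move=> fT [r rD rv]; exists r; rewrite // -shifts_morph // rv linear0. Qed.

Lemma gspace_morph_inj D v : injective f -> (forall v, f (T v) = T' (f v)) ->
  gspace T' D (f v) -> gspace T D v.
Proof.
move=> fI fT [r rD rv]; exists r => //; apply: fI.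
by rewrite shifts_morph // rv linear0.
Qed.

(** The commutation rule gives [(T - (x + 1)) B = B (T - x)], so a whole product moves past [B] once
    every root is raised by one. *)
Lemma gspace_raise (B : {linear M -> M}) D E v :
    (forall v, T (B v) = B (T v) + B v) -> (forall x, D x -> E (x + 1)) ->
  gspace T D v -> gspace T E (B v).
Proof.
move=> TB DE [r rD rv]; exists [seq x + 1 | x <- r].
  by move=> _ /mapP[x xr ->]; apply/DE/rD.
suff -> : shifts T [seq x + 1 | x <- r] (B v) = B (shifts T r v) by rewrite rv linear0.
elim: r {rD rv} => [|x r IH] //=.
by rewrite IH TB (linearB B) (linearZZ B) scalerDl scale1r opprD addrA addrAC addrK.
Qed.

End ShiftsMorphism.

(** * Products with finite support are direct sums *)

Section DProdTheory.
Variables (K : fieldType) (I : choiceType).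
Implicit Types V W : I -> lmodType K.

(** The inclusion of a summand. The family [V] is dependent, so [v] has to be transported along the
    decided equality of indices. *)
Definition dinj V (i : I) (v : V i) : dprod V := fun j =>
  if @eqP I i j is ReflectT e then eq_rect i (fun k => V k : Type) v j e else 0.

Lemma dinj_eq V i (v : V i) : dinj v i = v.
Proof. by rewrite /dinj; case: eqP => // e; rewrite (eq_axiomK e). Qed.

Lemma dinj_neq V i j (v : V i) : i <> j -> dinj v j = 0.
Proof. by rewrite /dinj; case: eqP. Qed.

Lemma dinj_linear V i : linear (@dinj V i).
Proof.
move=> c u v; apply: functional_extensionality_dep => j.
rewrite dprodDE dprodZE; have [<-|ij] := pselect (i = j); first by rewrite !dinj_eq.
by rewrite !dinj_neq // scaler0 addr0.
Qed.

HB.instance Definition _ V i :=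
  GRing.isLinear.Build K (V i) (dprod V) _ (@dinj V i) (@dinj_linear V i).

Definition dproj V i (f : dprod V) : V i := f i.

Lemma dproj_linear V i : linear (@dproj V i). Proof. by []. Qed.

HB.instance Definition _ V i :=
  GRing.isLinear.Build K (dprod V) (V i) _ (@dproj V i) (@dproj_linear V i).

Lemma dprod_sumE V (J : Type) (s : seq J) (P : pred J) (F : J -> dprod V) i :
  (\sum_(j <- s | P j) F j) i = \sum_(j <- s | P j) F j i.
Proof. exact: (linear_sum (@dproj V i)). Qed.

Definition dmap V W (f : forall i, V i -> W i) (v : dprod V) : dprod W :=
  fun i => f i (v i).

Lemma dmap_linear V W (f : forall i, {linear V i -> W i}) : linear (dmap f).
Proof.
by move=> c u v; apply: functional_extensionality_dep => i; rewrite /dmap linearP.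
Qed.

HB.instance Definition _ V W (f : forall i, {linear V i -> W i}) :=
  GRing.isLinear.Build K (dprod V) (dprod W) _ (dmap f) (dmap_linear f).

Lemma dmap_dinj V W (f : forall i, {linear V i -> W i}) i (v : V i) :
  dmap f (dinj v) = dinj (f i v).
Proof.
apply: functional_extensionality_dep => j; rewrite /dmap.
have [<-|ij] := pselect (i = j); first by rewrite !dinj_eq.
by rewrite !dinj_neq // linear0.
Qed.

Definition fin_supp V := finite_set [set i | ~ forall v : V i, v = 0].

Lemma fin_suppP V : fin_supp V ->
  exists2 s : seq I, uniq s & forall i, i \notin s -> forall v : V i, v = 0.
Proof.
move=> /finite_seqP[s sE]; exists (undup s); first exact: undup_uniq.
move=> i; rewrite mem_undup => /negP si; apply: contrapT => nz; apply: si.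
by have : [set` s] i by rewrite -sE.
Qed.

Lemma dprod_decomp V (s : seq I) (f : dprod V) :
    uniq s -> (forall i, i \notin s -> forall v : V i, v = 0) ->
  f = \sum_(i <- s) dinj (f i).
Proof.
move=> us s0; apply: functional_extensionality_dep => i; rewrite dprod_sumE.
have [si|si] := boolP (i \in s); last by rewrite (s0 _ si (f i)) [RHS]s0.
rewrite (bigD1_seq i) //= dinj_eq big1 ?addr0 // => j /eqP ji.
exact: dinj_neq.
Qed.

Lemma dprod_ext V (N : lmodType K) (u w : {linear dprod V -> N}) :
  fin_supp V -> (forall i (v : V i), u (dinj v) = w (dinj v)) -> u =1 w.
Proof.
move=> /fin_suppP[s us s0] uw f; rewrite (dprod_decomp f us s0) !linear_sum.
by apply: eq_bigr.
Qed.

Section Lift.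
Variables (V : I -> lmodType K) (N : lmodType K) (s : seq I).
Variable phi : forall i, {linear V i -> N}.

Definition dlift (f : dprod V) : N := \sum_(i <- s) phi i (f i).

Lemma dlift_linear : linear dlift.
Proof.
move=> c u v; rewrite /dlift scaler_sumr -big_split /=; apply: eq_bigr => i _.
by rewrite -linearP.
Qed.

HB.instance Definition _ := GRing.isLinear.Build K (dprod V) N _ dlift dlift_linear.

Lemma dlift_dinj : uniq s -> (forall i, i \notin s -> forall v : V i, v = 0) ->
  forall i (v : V i), dlift (dinj v) = phi i v.
Proof.
move=> us s0 i v; rewrite /dlift.
have [si|si] := boolP (i \in s).
  rewrite (bigD1_seq i) //= dinj_eq big1 ?addr0 // => j ji.
  by rewrite dinj_neq ?linear0 //; apply/nesym/eqP.
rewrite (s0 _ si v) !linear0 big1_seq // => j _; exact: linear0.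
Qed.

End Lift.

Lemma dprod_coproduct V (N : lmodType K) (phi : forall i, {linear V i -> N}) :
  fin_supp V -> exists u : {linear dprod V -> N}, forall i v, u (dinj v) = phi i v.
Proof. by move=> /fin_suppP[s us s0]; exists (dlift s phi); exact: dlift_dinj. Qed.

(** * Products graded by disjoint sets of eigenvalues *)

Section Graded.
Variable C : I -> set K.
Hypothesis C_disj : forall i j x, C i x -> C j x -> i = j.

Lemma dmap_gspace_proj V (T : forall i, {linear V i -> V i}) i j (f : dprod V) :
    (forall v, gspace (T j) (C j) v) -> i <> j ->
  gspace (dmap T) (C i) f -> f j = 0.
Proof.
move=> TC ij fi.
have := @gspace_morph _ _ _ (dmap T) (T j) (@dproj V j) (C i) f (fun=> erefl) fi.
move=> fj; apply: (gspace_disjoint _ fj (TC _)) => x xi xj.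
exact/ij/(C_disj xi xj).
Qed.

(** This is what makes both functors full. The image of the summand [V j] is annihilated by roots in
    [C j], whereas [W i] is annihilated by roots in [C i]; by disjointness the off-diagonal entries
    vanish. *)
Lemma dprod_hom_diag V W (T : forall i, {linear V i -> V i})
    (T' : forall i, {linear W i -> W i}) (g : {linear dprod V -> dprod W}) :
    fin_supp V ->
    (forall i v, gspace (T i) (C i) v) -> (forall i v, gspace (T' i) (C i) v) ->
    (forall f, g (dmap T f) = dmap T' (g f)) ->
  forall f i, g f i = g (dinj (f i)) i.
Proof.
move=> Vfin TC TC' gT f i.
apply: (@dprod_ext V (W i) (@dproj W i \o g) (@dproj W i \o g \o @dinj V i \o @dproj V i)) => //.
move=> j v /=; rewrite /dproj; have [<-|ij] := pselect (j = i); first by rewrite dinj_eq.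
rewrite (dinj_neq _ ij) linear0 linear0; apply: (dmap_gspace_proj (T := T')) ij _ => //.
have jv : gspace (dmap T) (C j) (dinj v).
  by apply: gspace_morph (TC j v) => w /=; rewrite dmap_dinj.
exact: gspace_morph jv.
Qed.

Lemma gspace_dprod V (T : forall i, {linear V i -> V i}) D :
    fin_supp V -> (forall i, C i `<=` D) -> (forall i v, gspace (T i) (C i) v) ->
  forall f, gspace (dmap T) D f.
Proof.
move=> /fin_suppP[s us s0] CD TC f; rewrite (dprod_decomp f us s0).
apply: gspace_sum => i _; apply: gspaceS (CD i) _.
by apply: gspace_morph (TC i (f i)) => v /=; rewrite dmap_dinj.
Qed.

(** Used for essential surjectivity of both functors. Surjectivity is [gspace_gsum]. For
    injectivity, in a vanishing sum the term at [i] is minus the sum of the others, so its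
    annihilating roots can be taken both in [C i] and outside it. *)
Lemma gspace_dlift_bij (N : lmodType K) (T : {linear N -> N}) V
    (phi : forall i, {linear V i -> N}) (u : {linear dprod V -> N}) :
    fin_supp V -> (forall i, injective (phi i)) ->
    (forall i w, gspace T (C i) w <-> exists v, phi i v = w) ->
    (forall w, gspace T [set x | exists i, C i x] w) ->
    (forall i v, u (dinj v) = phi i v) ->
  bijective u.
Proof.
move=> /fin_suppP[s us s0] phiI phiE Ncover uE.
have uI : injective u.
  move=> f g fg; apply/eqP; rewrite -subr_eq0; apply/eqP.
  have : u (f - g) = 0 by rewrite linearB fg subrr.
  move: (f - g) => {fg}f {g}; rewrite {1}(dprod_decomp f us s0) linear_sum => f0.
  apply: functional_extensionality_dep => i; rewrite dprod0E.
  have [si|si] := boolP (i \in s); last exact: s0.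
  apply: (phiI i); rewrite linear0.
  have phi_in j : gspace T (C j) (phi j (f j)) by apply/phiE; exists (f j).
  apply: (gspace_disjoint (D := C i) (E := [set x | exists2 j, i <> j & C j x])) (phi_in i) _.
    by move=> x xi [j ij /(C_disj xi)].
  move: f0; rewrite (bigD1_seq i) //= uE => /eqP; rewrite addr_eq0 => /eqP ->.
  apply: gspaceN; apply: gspace_sum => j ji; rewrite uE; apply: gspaceS (phi_in j).
  by move=> x xj; exists j => //; apply/nesym/eqP.
have uS w : exists f, u f = w.
  elim: (gspace_gsum C_disj (Ncover w)) => [|i v1 v2 /phiE[v <-] _ [f <-]].
    by exists 0; rewrite linear0.
  by exists (dinj v + f); rewrite linearD uE.
have [h hK] := choice uS; exists h => // f; apply: uI; exact: hK.
Qed.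

End Graded.
End DProdTheory.

(** * Finite dimension, simple modules and finite length *)

Section FiniteDimension.
Variable K : fieldType.
Implicit Types M N U V : lmodType K.

(** The modules are arbitrary [lmodType]s without a chosen basis; an injection into a row space is
    all that the dimension arguments below start from. *)
Definition fin_dim M : Prop :=
  exists n (j : {linear M -> 'rV[K]_n}), injective j.

Lemma linear_rV_inj_leq m n (f : {linear 'rV[K]_m -> 'rV[K]_n}) : injective f -> (m <= n)%N.
Proof.
move=> fI; have /eqP <- : row_free (lin1_mx f); last exact: rank_leq_col.
apply: inj_row_free => v; rewrite mul_rV_lin1 => fv.
by apply: fI; rewrite fv linear0.
Qed.

(** A pointwise lift is chosen classically; injectivity of [phi] forces it to be linear. *)
Lemma factor_through M U V (phi : {linear V -> M}) (f : {linear U -> M}) :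
    injective phi -> (forall u, exists v, phi v = f u) ->
  exists g : {linear U -> V}, forall u, phi (g u) = f u.
Proof.
move=> phiI /choice[g gP].
have gl : linear g by move=> c u v; apply: phiI; rewrite linearP /= !gP linearP.
by exists (linear_of gl).
Qed.

Lemma linear_bij_inv M N (f : {linear M -> N}) : bijective f ->
  exists g : {linear N -> M}, cancel f g /\ cancel g f.
Proof.
move=> [g fK gK].
have gl : linear g by move=> c u v; apply: (can_inj fK); rewrite linearP /= !gK.
by exists (linear_of gl).
Qed.

(* A linear injection into [P] from a row space of maximal dimension is onto [P]. *)
Lemma subspace_coordinates M (P : set M) : fin_dim M -> P 0 ->
    (forall c u v, P u -> P v -> P (c *: u + v)) ->
  exists n (phi : {linear 'rV[K]_n -> M}),
    injective phi /\ forall v, P v <-> exists x, phi x = v.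
Proof.
move=> [n [j jI]] P0 PD.
pose Q r := `[< exists phi : {linear 'rV[K]_r -> M}, injective phi /\ forall x, P (phi x) >].
have exQ : exists r, Q r.
  exists 0%N; apply/asboolP.
  exists (@linear_of K _ _ (fun=> 0) (fun c u v => esym (etrans (addr0 _) (scaler0 _ c)))).
  by split=> // x y _; rewrite [x]thinmx0 [y]thinmx0.
have Qle r : Q r -> (r <= n)%N.
  move=> /asboolP[phi [phiI _]].
  by apply: (@linear_rV_inj_leq r n (j \o phi)); exact: inj_comp.
case: (ex_maxnP exQ Qle) => r /asboolP[phi [phiI phiP]] rmax.
exists r, phi; split=> // v; split=> [Pv|[x <-] //].
apply: contrapT => vphi; suff : Q (r + 1)%N by move=> /rmax; rewrite addn1 ltnn.
(* If [v] is missed by [phi], adding it as one more basis vector keeps the map injective: a kernel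
   element with nonzero last coordinate would express [v] through [phi]. *)
pose psi (x : 'rV[K]_(r + 1)) := phi (lsubmx x) + rsubmx x 0 0 *: v.
have psil : linear psi.
  move=> c x y; rewrite /psi !linearP /= !mxE scalerDr addrACA; congr (_ + _).
  by rewrite scalerDl scalerA.
apply/asboolP; exists (linear_of psil); split=> [|x] /=; last first.
  by rewrite /psi addrC; apply: PD.
apply: (raddf_inj (f := linear_of psil)) => x; rewrite /= /psi => x0.
have [rx0|rx0] := eqVneq (rsubmx x 0 0) 0.
  rewrite -[x]hsubmxK; move: x0; rewrite rx0 scale0r addr0 => lx.
  have -> : lsubmx x = 0 by apply: phiI; rewrite lx linear0.
  have -> : rsubmx x = 0 by apply/matrixP => a b; rewrite !ord1 rx0 mxE.
  exact: row_mx0.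
case: vphi; exists (- (rsubmx x 0 0)^-1 *: lsubmx x).
move: x0; rewrite linearZ /= => /eqP; rewrite addr_eq0 => /eqP ->.
by rewrite scalerN scaleNr opprK scalerA mulVf // scale1r.
Qed.

(** The vector [x] splits [p]: [v - p v *: x] lies in the kernel of [p], hence comes from [N], and
    its coordinates together with [p v] determine [v]. *)
Lemma fin_dim_extension N M (i : {linear N -> M}) (p : {linear M -> K^o}) x :
    injective i -> p x = 1 -> (forall v, p v = 0 -> exists w, i w = v) ->
  fin_dim N -> fin_dim M.
Proof.
move=> iI px pi [n [j jI]].
pose h v := v - p v *: x.
have hl : linear h.
  move=> c u v; rewrite /h linearP /= scalerDl scalerBr opprD addrACA.
  by rewrite scalerA.
have [|g gE] := @factor_through M M N i (linear_of hl) iI.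
  by move=> v /=; apply: pi; rewrite linearB linearZ /= px /GRing.scale /= mulr1 subrr.
pose k (v : M) : 'rV[K]_(n + 1) := row_mx (j (g v)) (const_mx (p v)).
have kl : linear k.
  move=> c u v; rewrite /k !linearP /= scale_row_mx add_row_mx; congr row_mx.
  by apply/matrixP => a b; rewrite !mxE.
exists (n + 1)%N, (linear_of kl); apply: raddf_inj => v /=.
rewrite -(row_mx0 K 1 n 1) => /eq_row_mx [jv /matrixP/(_ 0 0)].
rewrite !mxE => pv; have gv : g v = 0 by apply: jI; rewrite jv linear0.
by have := gE v; rewrite gv linear0 /= /h pv scale0r subr0.
Qed.

Lemma fin_dim_rV n : fin_dim 'rV[K]_n.
Proof. by exists n, idfun. Qed.

Lemma fin_dim_vect (V : vectType K) : fin_dim V.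
Proof.
pose j (v : V) : 'rV[K]_(\dim {:V}) := \row_i coord (vbasis {:V}) i v.
have jl : linear j by move=> c u v; apply/rowP => i; rewrite !mxE linearP.
exists _, (linear_of jl); apply: (raddf_inj (f := linear_of jl)) => v /rowP j0.
rewrite (coord_vbasis (memvf v)) big1 // => i _.
by have := j0 i; rewrite !mxE => ->; rewrite scale0r.
Qed.

Lemma fin_dim_dprod (I : choiceType) (V : I -> lmodType K) : fin_supp V ->
  (forall i, fin_dim (V i)) -> fin_dim (dprod V).
Proof.
move=> /fin_suppP[s _ s0] Vfd.
(* Injectivity is weakened to vanishing on [s], a form that allows induction on [s]. *)
suff [n [j jI]] : exists n (j : {linear dprod V -> 'rV[K]_n}),
    forall f, j f = 0 -> {in s, forall i, f i = 0}.
  exists n, j; apply: raddf_inj => f /jI f0.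
  apply: functional_extensionality_dep => i; rewrite dprod0E.
  by have [/f0|/s0] := boolP (i \in s).
elim: s {s0} => [|i s [n [j jI]]].
  exists 0%N, (linear_of (fun c u v => esym (etrans (addr0 _) (scaler0 _ c)))
    : {linear dprod V -> 'rV[K]_0}).
  by move=> f _ i; rewrite in_nil.
have [m [k kI]] := Vfd i.
pose h (f : dprod V) : 'rV[K]_(m + n) := row_mx (k (f i)) (j f).
have hl : linear h by move=> c f g; rewrite /h !linearP /= scale_row_mx add_row_mx.
exists (m + n)%N, (linear_of hl) => f /=; rewrite -(row_mx0 K 1 m n) => /eq_row_mx[kf jf] l.
rewrite inE => /orP[/eqP ->|]; last exact: jI.
by apply: kI; rewrite kf linear0.
Qed.

Lemma locally_nilpotent_ker M (T : {linear M -> M}) (v : M) :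
  locally_nilpotent 0 T -> v != 0 -> exists2 w, w != 0 & T w = 0.
Proof.
move=> /(_ v)[n]; elim: n v => [|n IH] v /=; first by move=> -> /eqP.
rewrite -iterS iterSr => Tv v0; have [Tv0|Tv0] := eqVneq (T v) 0; first by exists v.
exact: IH Tv Tv0.
Qed.

End FiniteDimension.

(** * Inverses of module morphisms, and local nilpotency along them *)

Section LieModuleHom.
Variables (K : fieldType) (g : lie_algebra K).
Implicit Types M N : lie_module g.

Lemma linear_lie_hom_subproof M N (f : {linear M -> N}) :
  (forall (x : g) v, f (act x v) = act x (f v)) -> (f : M -> N) \in @lie_hom_pred K g M N.
Proof. by move=> fa; apply/asboolP; split; [exact: linearP|exact: fa]. Qed.

Definition linear_lie_hom M N (f : {linear M -> N})
    (fa : forall (x : g) v, f (act x v) = act x (f v)) : lie_hom M N :=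
  LieHom (linear_lie_hom_subproof fa).

Lemma lie_hom_inverse M N (f : lie_hom M N) : bijective f ->
  exists h : lie_hom N M, cancel f h /\ cancel h f.
Proof.
move=> fb; have [h [fK hK]] := linear_bij_inv (f := f : {linear M -> N}) fb.
have ha (x : g) v : h (act x v) = act x (h v).
  by apply: (can_inj fK); rewrite /= lie_hom_act !hK.
by exists (linear_lie_hom ha).
Qed.

Lemma bijective_is_iso M N (f : lie_hom M N) : bijective f ->
  @is_iso K (lie_module_category g) M N f.
Proof.
move=> /lie_hom_inverse[h [fK hK]].
by exists h; split; apply: lie_hom_ext => v; [exact: fK|exact: hK].
Qed.

Lemma locally_nilpotent_lie_inj M N (f : lie_hom M N) (x : g) : injective f ->
  locally_nilpotent 0 (@act K g N x) -> locally_nilpotent 0 (@act K g M x).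
Proof.
move=> fI nilN v; have [n fv] := nilN (f v); exists n; apply: fI.
rewrite linear0 -{}fv; elim: n => //= n <-; exact: lie_hom_act.
Qed.

Lemma locally_nilpotent_lie_surj M N (f : lie_hom M N) (x : g) :
    (forall w, exists v, f v = w) ->
  locally_nilpotent 0 (@act K g M x) -> locally_nilpotent 0 (@act K g N x).
Proof.
move=> fS nilM w; have [v <-] := fS w; have [n fv] := nilM v; exists n.
rewrite -[RHS](linear0 f) -{}fv; elim: n => //= n ->; exact/esym/lie_hom_act.
Qed.

Lemma lie_hom_kernel M N (f : lie_hom M N) : is_submodule [set v | f v = 0].
Proof.
split=> [|c u v fu fv|x v fv] /=; first exact: linear0.
  by rewrite lie_hom_linear fu fv scaler0 addr0.
by rewrite lie_hom_act fv linear0.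
Qed.

End LieModuleHom.

(** * Modules over the two-dimensional algebra as pairs of operators *)

Section TwoDimensionalAlgebra.
Variable K : fieldType.
Local Notation g := (g_alg K).
Local Notation ga := (@ga K).
Local Notation gb := (@gb K).

Lemma act_ab (M : lie_module g) (x : g) (v : M) :
  act x v = x.1 *: act ga v + x.2 *: act gb v.
Proof.
have act0 : act 0 v = 0.
  by apply: (addrI (act ga v)); have := act_linl v 1 ga 0; rewrite !scale1r !addr0 => <-.
rewrite {1}(g_basis x) act_linl; congr (_ + _).
by have := act_linl v x.2 gb 0; rewrite act0 !addr0.
Qed.

Lemma act_a_b (M : lie_module g) (v : M) :
  act ga (act gb v) = act gb (act ga v) + act gb v.
Proof. by rewrite -{3}(g_bracket_ab K) act_bracket addrC subrK. Qed.

Section FromOperators.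
Variables (M : lmodType K) (A B : {linear M -> M}).
Hypothesis AB : forall v, A (B v) = B (A v) + B v.

(** Since [[a, b] = b], a pair of operators with [A B = B A + B] is the same as a module. Submodules
    in coordinates and the modules of quiver representations are built in this way. *)
Definition ab_act (x : g) (v : M) : M := x.1 *: A v + x.2 *: B v.

Lemma ab_act_linl v : linear (ab_act^~ v).
Proof.
move=> c x y; rewrite /ab_act.
rewrite -[(_ + _).1]/(c * x.1 + y.1) -[(_ + _).2]/(c * x.2 + y.2).
by rewrite !scalerDl scalerDr addrACA !scalerA.
Qed.

Lemma ab_act_linr x : linear (ab_act x).
Proof.
move=> c u v; by rewrite /ab_act (linearP A) (linearP B) !scalerDr addrACA !scalerA !(mulrC c).
Qed.

Lemma ab_act_bracket x y v :
  ab_act (bracket x y) v = ab_act x (ab_act y v) - ab_act y (ab_act x v).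
Proof.
case: x y => [s t] [s' t']; rewrite /ab_act /= scale0r add0r.
rewrite !(linearD A, linearD B, linearZZ A, linearZZ B) !AB.
rewrite !scalerDr !scalerA !opprD !addrA scalerBl !(mulrC s') !(mulrC t').
(* Only the third and the eighth of the ten terms, those in [B v], survive; the other eight cancel
   in pairs. *)
by rewrite [RHS](ACl (3*8*(1*6)*(2*9)*(4*7)*(5*10)))/= !subrr !addr0.
Qed.

Definition ab_module : lie_module g := LieModule ab_act_linl ab_act_linr ab_act_bracket.

Lemma ab_module_a v : act ga (v : ab_module) = A v.
Proof. by rewrite /= /ab_act scale1r scale0r addr0. Qed.

Lemma ab_module_b v : act gb (v : ab_module) = B v.
Proof. by rewrite /= /ab_act scale1r scale0r add0r. Qed.

End FromOperators.

Lemma ab_lie_hom (M N : lie_module g) (f : {linear M -> N}) :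
    (forall v, f (act ga v) = act ga (f v)) -> (forall v, f (act gb v) = act gb (f v)) ->
  forall (x : g) v, f (act x v) = act x (f v).
Proof. by move=> fa fb x v; rewrite !(act_ab x) linearP linearZ /= fa fb. Qed.

(** Turns a submodule given as a subset into a module of its own, by carrying the restrictions of
    [a] and [b] over to a row space. *)
Lemma submodule_coordinates (M : lie_module g) (P : set M) :
    fin_dim M -> is_submodule P ->
  exists (N : lie_module g) (i : lie_hom N M),
    [/\ fin_dim N, injective i & forall v, P v <-> exists w, i w = v].
Proof.
move=> Mfd [P0 PD Pact]; have [n [phi [phiI phiP]]] := subspace_coordinates Mfd P0 PD.
have factor x : exists h : {linear 'rV[K]_n -> 'rV[K]_n}, forall w, phi (h w) = act x (phi w).
  apply: (factor_through (f := @act K g M x \o phi) phiI) => w.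
  by apply/phiP/Pact/phiP; exists w.
have [A phiA] := factor ga; have [B phiB] := factor gb.
have AB v : A (B v) = B (A v) + B v.
  by apply: phiI; rewrite linearD /= !(phiA, phiB) act_a_b.
pose N := ab_module AB; have phi_hom : forall x v, phi (@act K g N x v) = act x (phi v).
  by apply: (@ab_lie_hom N M phi) => v; rewrite (ab_module_a, ab_module_b) ?phiA ?phiB.
by exists N, (linear_lie_hom phi_hom); split=> //; exact: fin_dim_rV.
Qed.

End TwoDimensionalAlgebra.

(** * Polynomials in an operator applied to a fixed vector *)

Section PolynomialOfOperator.
Variables (K : fieldType) (M : lmodType K) (T : {linear M -> M}) (v : M).
Implicit Types p q : {poly K}.

Definition poly_act p : M := \sum_(i < size p) p`_i *: iter i T v.

Lemma poly_act_widen n p : (size p <= n)%N ->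
  poly_act p = \sum_(i < n) p`_i *: iter i T v.
Proof.
move=> pn; rewrite /poly_act (big_ord_widen n (fun i => p`_i *: iter i T v) pn).
rewrite big_mkcond; apply: eq_bigr => i _; case: ltnP => // pi.
by rewrite nth_default // scale0r.
Qed.

Lemma poly_act_linear : linear poly_act.
Proof.
move=> c p q; set n := maxn (size (c *: p + q)) (maxn (size p) (size q)).
rewrite !(poly_act_widen (n := n)) ?leq_max ?leqnn ?orbT //.
rewrite scaler_sumr -big_split; apply: eq_bigr => i _ /=.
by rewrite coefD coefZ scalerDl scalerA.
Qed.

HB.instance Definition _ :=
  GRing.isLinear.Build K {poly K} M _ poly_act poly_act_linear.

Lemma poly_actMX p : poly_act (p * 'X) = T (poly_act p).
Proof.
rewrite (@poly_act_widen (size p).+1); last first.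
  by apply: leq_trans (size_polyMleq _ _) _; rewrite size_polyX addn2.
rewrite big_ord_recl coefMX scale0r add0r linear_sum; apply: eq_bigr => i _.
by rewrite coefMX linearZ.
Qed.

Lemma poly_act1 : poly_act 1 = v.
Proof. by rewrite (@poly_act_widen 1) ?size_poly1 // big_ord1 coef1 scale1r. Qed.

Lemma poly_act_prod (r : seq K) : poly_act (\prod_(z <- r) ('X - z%:P)) = shifts T r v.
Proof.
elim: r => [|x r IH]; first by rewrite big_nil poly_act1.
rewrite big_cons mulrBl linearB /= mulrC poly_actMX mul_polyC.
by rewrite [X in _ - X]linearZ /= IH.
Qed.

(** Apply the factors one after the other: the last nonzero vector is an eigenvector. *)
Lemma shifts_ex_eigen (r : seq K) : v != 0 -> shifts T r v = 0 ->
  exists x w, w != 0 /\ T w = x *: w.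
Proof.
move=> v0; elim: r => [|x r IH] /= => [/eqP|]; first by rewrite (negbTE v0).
have [/IH //|w0 /eqP] := eqVneq (shifts T r v) 0.
by rewrite subr_eq0 => /eqP Tw; exists x, (shifts T r v).
Qed.

End PolynomialOfOperator.

(** * Simple modules with [b] locally nilpotent *)

Section SimpleModules.
Variable K : fieldType.
Local Notation g := (g_alg K).
Local Notation ga := (@ga K).
Local Notation gb := (@gb K).

Lemma ab_submodule (M : lie_module g) (P : set M) :
    P 0 -> (forall c u v, P u -> P v -> P (c *: u + v)) ->
    (forall v, P v -> P (act ga v)) -> (forall v, P v -> P (act gb v)) ->
  is_submodule P.
Proof.
move=> P0 PD Pa Pb; split=> // x v Pv; rewrite act_ab; apply: (PD); first exact: Pa.
by rewrite -[_ *: _]addr0; apply: PD => //; exact: Pb.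
Qed.

Lemma L_simple (mu : K) : simple_module (L mu).
Proof.
split=> [/(_ (1 : K))/eqP|N [N0 ND _]]; first by rewrite (negbTE (oner_neq0 K)).
have [Nz|/existsNP[c /not_implyP[Nc c0]]] := pselect (forall c : K, N c -> c = 0).
  by left; apply/seteqP; split=> [c /Nz|c ->].
right; apply/seteqP; split=> // x _.
have := ND (x / c) c 0 Nc N0; rewrite addr0 /GRing.scale /= divfK //.
exact/eqP.
Qed.

Lemma simple_ker_b (S : lie_module g) : simple_module S ->
  locally_nilpotent 0 (@act K g S gb) -> forall v : S, act gb v = 0.
Proof.
move=> [/existsNP[v /eqP v0] simS] nil.
have [w w0 bw] := locally_nilpotent_ker nil v0.
case: (simS [set u | act gb u = 0]) => [|E|E u].
- apply: ab_submodule => [|c x y /= bx by_|x /= bx|x /= bx].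
  + exact: linear0.
  + by rewrite linearP /= bx by_ scaler0 addr0.
  + by apply: (addIr (act gb x)); rewrite -act_a_b bx linear0 addr0.
  + by rewrite bx linear0.
- have : [set 0] w by rewrite -E.
  by move=> /eqP; rewrite (negbTE w0).
- by have : setT u by []; rewrite -E.
Qed.

End SimpleModules.

Section SimpleModulesClosedField.
Variable K : closedFieldType.
Local Notation g := (g_alg K).
Local Notation ga := (@ga K).
Local Notation gb := (@gb K).

Lemma simple_isomorphic_L (S : lie_module g) : simple_module S ->
  locally_nilpotent 0 (@act K g S gb) -> exists mu, isomorphic S (L mu).
Proof.
move=> simS nil; have b0 := simple_ker_b simS nil.
case: simS => [/existsNP[v /eqP v0] simS].
pose T : {linear S -> S} := @act K g S ga.
have [mu [w [w0 Tw]]] : exists mu w, w != 0 /\ T w = mu *: w.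
  (* [S] is not known to be finite dimensional. Take the submodule of all [T (p(T) v)]. If it is
     zero, [v] is an eigenvector for 0. If it is everything, it contains [v], so some [p * 'X - 1]
     kills [v]; its constant term is -1, so it is a nonzero split polynomial and yields an
     eigenvector. *)
  case: (simS [set w | exists p, w = poly_act T v (p * 'X)]) => [|E|E].
  - apply: ab_submodule => [|c _ _ [p ->] [q ->]|_ [p ->]|_ [p ->]] /=.
    + by exists 0; rewrite mul0r linear0.
    + by exists (c *: p + q); rewrite mulrDl -scalerAl [RHS]linearP.
    + by exists (p * 'X); rewrite -[act ga _]/(T _) -poly_actMX.
    + by exists 0; rewrite b0 mul0r linear0.
  - exists 0, v; split; rewrite // scale0r.
    have : [set 0] (poly_act T v (1 * 'X)) by rewrite -E; exists 1.
    by rewrite poly_actMX poly_act1.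
  - have : setT v by []; rewrite -E => -[p pv].
    have [r pr] := closed_field_poly_normal (p * 'X - 1).
    apply: (@shifts_ex_eigen K S T v r) => //; rewrite -poly_act_prod.
    have : poly_act T v (p * 'X - 1) = 0 by rewrite linearB /= -pv poly_act1 subrr.
    rewrite {1}pr linearZ /= => /eqP; rewrite scaler_eq0 lead_coef_eq0.
    case/orP => [/eqP/(congr1 (fun q : {poly K} => q`_0))|/eqP //].
    rewrite coefB coefMX coef1 coef0 sub0r => /eqP.
    by rewrite oppr_eq0 oner_eq0.
(* The [mu]-eigenspace and then the line through [w] are nonzero submodules, hence all of [S]. *)
have Tmu u : T u = mu *: u.
  case: (simS [set u | T u = mu *: u]) => [|E|E].
  - apply: ab_submodule => [|c x y /= Tx Ty|x /= Tx|x /= Tx].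
    + by rewrite /= (linear0 T) scaler0.
    + by rewrite (linearP T) (Tx : T x = _) (Ty : T y = _) scalerDr !scalerA mulrC.
    + by rewrite Tx linearZ /= Tx.
    + by rewrite b0 linear0 scaler0.
  - have : [set 0] w by rewrite -E.
    by move=> /eqP; rewrite (negbTE w0).
  - by have : setT u by []; rewrite -E.
have Sw u : exists c, u = c *: w.
  case: (simS [set u | exists c, u = c *: w]) => [|E|E].
  - apply: ab_submodule => [|c _ _ [p ->] [q ->]|_ [p ->]|_ [p ->]] /=.
    + by exists 0; rewrite scale0r.
    + by exists (c * p + q); rewrite scalerDl scalerA.
    + by exists (mu * p); rewrite -[act ga _]/(T _) Tmu scalerA.
    + by exists 0; rewrite b0 scale0r.
  - have : [set 0] w by rewrite -E; exists 1; rewrite scale1r.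
    by move=> /eqP; rewrite (negbTE w0).
  - by have : setT u by []; rewrite -E.
exists mu; pose f (c : L mu) : S := (c : K) *: w.
have fl : linear f by move=> c x y; rewrite /f scalerDl scalerA.
have f_hom (x : g) c : f (act x c) = act x (f c).
  apply: (@ab_lie_hom K (L mu) S (linear_of fl)) => {x}c.
    by rewrite -[RHS]/(T (f c)) Tmu L_a /= /f scalerA.
  by rewrite L_b b0 linear0.
have f_bij : bijective f.
  have [h hP] := choice Sw; exists h => [c|u]; last by rewrite /f -hP.
  apply/eqP; rewrite -subr_eq0; have /eqP := hP (f c).
  by rewrite /f eq_sym -subr_eq0 -scalerBl scaler_eq0 (negbTE w0) orbF.
have [h [fK hK]] := @lie_hom_inverse K g (L mu) S (linear_lie_hom (f := linear_of fl) f_hom) f_bij.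
by exists h; exists f.
Qed.

End SimpleModulesClosedField.

(** * Finite length against finite dimension *)

Section FiniteLength.
Variable K : closedFieldType.
Local Notation g := (g_alg K).
Local Notation ga := (@ga K).
Local Notation gb := (@gb K).
Implicit Types M N S : lie_module g.

Lemma locally_nilpotent_subquotient S M : subquotient S M ->
  locally_nilpotent 0 (@act K g M gb) -> locally_nilpotent 0 (@act K g S gb).
Proof.
move=> [N [i [p [iI pS]]]] /(locally_nilpotent_lie_inj iI).
exact: locally_nilpotent_lie_surj.
Qed.

Lemma gspace_subquotient S M (D : set K) : subquotient S M ->
  (forall v : M, gspace (@act K g M ga) D v) -> forall v : S, gspace (@act K g S ga) D v.
Proof.
move=> [N [i [p [iI pS]]]] MD v; have [w <-] := pS v.
apply: gspace_morph => [u|]; first exact: lie_hom_act.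
by apply: (gspace_morph_inj iI _ (MD (i w))) => u; exact: lie_hom_act.
Qed.

(** The simple subquotient is some [L mu], and annihilation by roots in [D] passes to it; the vector
    1 of [L mu] is an eigenvector for [mu], so [mu] lies in [D]. *)
Lemma simple_subquotient_gspace M (D : set K) :
    locally_nilpotent 0 (@act K g M gb) ->
    (forall v : M, gspace (@act K g M ga) D v) ->
  forall S, simple_module S -> subquotient S M -> exists2 mu, D mu & isomorphic S (L mu).
Proof.
move=> nil MD S simS subS.
have [mu isoS] := simple_isomorphic_L simS (locally_nilpotent_subquotient subS nil).
exists mu => //; have [f [h fK hK]] := isoS.
have one0 : (1 : K) != 0 by exact: oner_neq0.
apply: (@gspace_eigen _ _ (@act K g (L mu) ga) D mu (1 : K)) => //; first exact: L_a.
rewrite -(hK (1 : K)); apply: gspace_morph; last exact: (gspace_subquotient subS).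
exact: lie_hom_act.
Qed.

(** Each composition factor [L mu] contributes one coordinate and one root. The condition on
    subquotients is inherited by submodules, which keeps all roots in [D]; with [D] a coset this
    describes a block. *)
Lemma finite_length_decomposition M (D : set K) : finite_length M ->
    locally_nilpotent 0 (@act K g M gb) ->
    (forall S, simple_module S -> subquotient S M -> exists2 mu, D mu & isomorphic S (L mu)) ->
  fin_dim M /\ exists2 r, {in r, forall x, D x} & forall v : M, shifts (@act K g M ga) r v = 0.
Proof.
elim=> {M} [M M0|M P S i p [iI pS ip] _ IH simS] nil MD.
  split; last by exists [::] => // v; exact: M0.
  exists 0%N, (linear_of (fun c u v => esym (etrans (addr0 _) (scaler0 _ c)))
    : {linear M -> 'rV[K]_0}) => u v _.
  by rewrite (M0 u) (M0 v).
have [||Mfd [r rD rM]] := IH.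
- exact: locally_nilpotent_lie_inj iI nil.
- move=> S' simS' [N [j [q [jI qS]]]]; apply: MD simS' _.
  by exists N, (lie_comp i j), q; split=> // u v /iI /jI.
have [|mu Dmu [f f_bij]] := MD S simS.
  by exists P, (lie_id P), p; split=> // u v.
have [h [fK hK]] := lie_hom_inverse f_bij.
pose pK : {linear P -> K^o} := (f : {linear S -> L mu}) \o p.
have [x px] := pS (h (1 : K)).
split.
  apply: (@fin_dim_extension K M P i pK x) => //; first by rewrite /pK /= px hK.
  move=> v pv; apply/ip; apply: (can_inj fK).
  by rewrite linear0; exact: pv.
(* [a - mu] acts first and maps into the kernel of [p], that is, into the submodule that [r]
   annihilates. *)
exists (rcons r mu) => [y|v].
  by rewrite mem_rcons inE => /orP[/eqP ->|/rD].
rewrite -cats1 shifts_cat /=.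
have /ip[w <-] : p (act ga v - mu *: v) = 0.
  apply: (can_inj fK); rewrite !linear0 linearB linearZ /= lie_hom_act linearB linearZ /=.
  by rewrite lie_hom_act L_a subrr.
rewrite -(shifts_morph (T := @act K g M ga) (f := i)) ?rM ?linear0 // => u.
exact: lie_hom_act.
Qed.

Lemma finite_length_fin_dim M : finite_length M ->
    locally_nilpotent 0 (@act K g M gb) ->
  fin_dim M /\ exists r, forall v : M, shifts (@act K g M ga) r v = 0.
Proof.
move=> lM nil; have [|Mfd [r _ rM]] := finite_length_decomposition (D := setT) lM nil.
  move=> S simS subS.
  have [mu isoS] := simple_isomorphic_L simS (locally_nilpotent_subquotient subS nil).
  by exists mu.
by split=> //; exists r.
Qed.

(* A common eigenvector of the transposed matrices: the kernel of the
   transpose of [B] is nonzero and stable under the transpose of [A]. *)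
Lemma matrix_eigen_functional n (A B : 'M[K]_n) (v : 'rV[K]_n) :
    B *m A = A *m B + B -> v != 0 -> v *m B = 0 ->
  exists mu (l : 'cV[K]_n), [/\ l != 0, A *m l = mu *: l & B *m l = 0].
Proof.
move=> BA v0 vB; pose k := kermx B^T; pose U := row_base k.
have kB : k *m B^T = 0 by exact: mulmx_ker.
have k0 : k != 0.
  (* The vector [v] shows that [B] is not invertible, so neither is its transpose. *)
  rewrite kermx_eq0 -row_leq_rank mxrank_tr row_leq_rank; apply/negP => /row_freeP[B' BB'].
  by move: v0; rewrite -[v]mulmx1 -BB' mulmxA vB mul0mx eqxx.
have UB : U *m B^T = 0 by apply/eqP; rewrite -sub_kermx eq_row_base.
have UA : (U *m A^T <= U)%MS.
  rewrite eq_row_base /k sub_kermx -mulmxA -trmx_mul BA linearD /= mulmxDr.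
  by rewrite trmx_mul mulmxA UB mul0mx addr0.
have /submxP[X UX] := UA.
have [mu /eigenvalueP[w wX w0]] : exists mu, eigenvalue X mu.
  have /closed_rootP[mu muX] : size (char_poly X) != 1%N.
    by rewrite size_char_poly eqSS mxrank_eq0.
  by exists mu; rewrite eigenvalue_root_char.
exists mu, (w *m U)^T; split.
- rewrite -trmx0 (inj_eq trmx_inj) -[0](mul0mx _ U) (inj_eq (row_free_inj _)) //.
  exact: row_base_free.
- by rewrite -[A]trmxK -trmx_mul -mulmxA UX mulmxA wX -scalemxAl linearZ.
- by rewrite -[B]trmxK -trmx_mul -mulmxA UB mulmx0 trmx0.
Qed.

(* A common eigenvector in the dual is a morphism onto some [L mu]; its kernel
   has smaller dimension. *)
Lemma fin_dim_finite_length M : fin_dim M ->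
  locally_nilpotent 0 (@act K g M gb) -> finite_length M.
Proof.
move=> Mfd; have [n [phi [phiI phiS]]] :=
  @subspace_coordinates K M setT Mfd I (fun=> fun=> fun=> fun=> fun=> I).
have {}phiS v : exists x, phi x = v by apply/phiS.
elim/ltn_ind: n M Mfd phi phiI phiS => n IH M Mfd phi phiI phiS nil.
have [M0|/existsNP[v /eqP v0]] := pselect (forall v : M, v = 0).
  exact: finite_length0.
have [w w0 bw] := locally_nilpotent_ker nil v0.
have [x xw] := phiS w.
have lift (z : g) : exists A : 'M[K]_n, forall x, phi (x *m A) = act z (phi x).
  have [|h hP] := @factor_through K M _ _ phi (@act K g M z \o phi) phiI.
    by move=> u; exact: phiS.
  by exists (lin1_mx h) => u; rewrite mul_rV_lin1 hP.
have [A phiA] := lift ga; have [B phiB] := lift gb.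
(* Row vectors are multiplied on the right, so products come in the order opposite to that of
   operators. *)
have BA : B *m A = A *m B + B.
  apply/row_matrixP => i; rewrite !rowE; apply: phiI.
  by rewrite mulmxDr linearD /= !mulmxA !(phiA, phiB) act_a_b.
have [||mu [l [l0 Al Bl]]] := matrix_eigen_functional (v := x) BA.
- by apply: contraNneq w0 => x0; rewrite -xw x0 linear0.
- by apply: phiI; rewrite phiB xw bw linear0.
have [ell ellE] := @factor_through K M M 'rV[K]_n phi idfun phiI phiS.
pose p (v : M) : L mu := (ell v *m l) 0 0.
have pl : linear p.
  by move=> a y z; rewrite /p linearP /= mulmxDl -scalemxAl !mxE.
have p_phi y : p (phi y) = (y *m l) 0 0.
  by rewrite /p; congr ((_ *m l) 0 0); apply: phiI; rewrite ellE.
have p_hom : forall (z : g) v, linear_of pl (act z v) = act z (linear_of pl v).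
  apply: ab_lie_hom => u; have [y <-] := phiS u.
    rewrite L_a -phiA -[LHS]/(p _) -[linear_of pl _]/(p _) !p_phi.
    by rewrite -mulmxA Al -scalemxAr mxE.
  by rewrite L_b -phiB -[LHS]/(p _) p_phi -mulmxA Bl mulmx0 mxE.
pose pM := linear_lie_hom p_hom.
have pS : surjective_hom pM.
  have [i li] : exists i, l i 0 != 0.
    apply: contrapT => l_eq0; move/eqP: l0; apply; apply/matrixP => i j.
    rewrite !ord1 mxE; apply: contrapT => li; apply: l_eq0; exists i; exact/eqP.
  move=> a; exists (phi ((a / l i 0) *: delta_mx 0 i)).
  by rewrite /pM /= p_phi -scalemxAl -rowE !mxE divfK.
have [N [i [Nfd iI iE]]] := submodule_coordinates Mfd (lie_hom_kernel pM).
apply: (finite_lengthS (i := i) (p := pM) _ _ (L_simple mu)); first by split.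
have nilN := locally_nilpotent_lie_inj iI nil.
have [m [psi [psiI psiS]]] :=
  @subspace_coordinates K N setT Nfd I (fun=> fun=> fun=> fun=> fun=> I).
apply: (IH m _ N Nfd psi psiI) => //; last by move=> u; apply/psiS.
have [|h hP] := @factor_through K M _ _ phi ((i : {linear N -> M}) \o psi) phiI.
  by move=> u; exact: phiS.
have hI : injective h by move=> a b hab; apply/psiI/iI; rewrite -[LHS]hP hab hP.
(* If the dimensions agreed, [h] would be invertible and [i] onto, so a vector with image 1 under
   [p] would lie in the kernel. *)
rewrite ltn_neqAle (linear_rV_inj_leq hI) andbT; apply/eqP => mn; subst m.
have h_unit : lin1_mx h \in unitmx.
  by rewrite -row_free_unit; apply: inj_row_free => u; rewrite mul_rV_lin1 => hu;
     apply: hI; rewrite hu linear0.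
have [y py] := pS (1 : K).
have [z phiz] := phiS y.
have : exists w, i w = y.
  exists (psi (z *m invmx (lin1_mx h))).
  by rewrite -[LHS]hP -mul_rV_lin1 mulmxKV.
by move=> /iE py0; have /eqP := oner_neq0 K; case; exact: etrans (esym py) py0.
Qed.

End FiniteLength.

(** * The decomposition into blocks *)

Section Equivalences.
Variable K : fieldType.
Implicit Types C D : category K.

(** The quasi-inverse chooses for every [Y] an object [X] with an isomorphism from [F X] to [Y], and
    pulls morphisms back along these isomorphisms. *)
Lemma fully_faithful_equivalence C D (F : functor C D) :
    (forall X Y, bijective (@fmap K C D F X Y)) ->
    (forall Y : D, exists (X : C) (e : Defs.hom (F X) Y), is_iso e) ->
  is_equivalence F.
Proof.
move=> Fbij Fes.
have pre X Y : {h : Defs.hom (F X) (F Y) -> Defs.hom X Y |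
    cancel (fmap F) h /\ cancel h (fmap F)}.
  by apply: cid; case: (Fbij X Y) => h fK hK; exists h.
have obj Y : {X : C & {e : Defs.hom (F X) Y & {e' : Defs.hom Y (F X) |
    Defs.comp e' e = idm (F X) /\ Defs.comp e e' = idm Y}}}.
  have [X /cid[e /cid[e' ee']]] := cid (Fes Y).
  by exists X, e, e'.
pose G0 Y := projT1 (obj Y).
pose e Y : Defs.hom (F (G0 Y)) Y := projT1 (projT2 (obj Y)).
pose e' Y : Defs.hom Y (F (G0 Y)) := sval (projT2 (projT2 (obj Y))).
have e'K Y : Defs.comp (e' Y) (e Y) = idm _ by case: (svalP (projT2 (projT2 (obj Y)))).
have eK Y : Defs.comp (e Y) (e' Y) = idm _ by case: (svalP (projT2 (projT2 (obj Y)))).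
pose lift X Y := sval (pre X Y).
have liftK X Y : cancel (lift X Y) (fmap F) by case: (svalP (pre X Y)).
have fmapK X Y : cancel (fmap F) (lift X Y) by case: (svalP (pre X Y)).
have fmap_inj X Y : injective (@fmap K C D F X Y) := can_inj (fmapK X Y).
pose G1 Y Z (f : Defs.hom Y Z) : Defs.hom (G0 Y) (G0 Z) :=
  lift _ _ (Defs.comp (e' Z) (Defs.comp f (e Y))).
have G1l Y Z : linear (@G1 Y Z).
  move=> c f h; apply: fmap_inj; rewrite fmap_linear !liftK.
  by rewrite comp_linl comp_linr.
have G11 Y : G1 Y Y (idm Y) = idm (G0 Y).
  by apply: fmap_inj; rewrite liftK fmap1 comp1m e'K.
have G1M Y Z W (h : Defs.hom Z W) (f : Defs.hom Y Z) :
    G1 Y W (Defs.comp h f) = Defs.comp (G1 Z W h) (G1 Y Z f).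
  by apply: fmap_inj; rewrite fmapM !liftK -!compA (compA (e Z)) eK comp1m.
exists (Functor G1l G11 G1M); split.
  exists (fun X => lift _ _ (e (F X))); split=> [X|X Y f].
    exists (lift _ _ (e' (F X))); split; apply: fmap_inj;
      by rewrite fmapM !liftK fmap1 ?e'K ?eK.
  by apply: fmap_inj; rewrite !fmapM /= !liftK compA eK comp1m.
exists e; split=> [Y|X Y f /=]; first by exists (e' Y).
by rewrite liftK compA eK comp1m.
Qed.

(** The functor constructed for (ii) goes from representations to modules, opposite to the claim;
    being quasi-inverse is symmetric. *)
Lemma is_equivalence_equivalent C D (F : functor C D) : is_equivalence F -> equivalent D C.
Proof. by move=> [G [eta eps]]; exists G, F; split. Qed.

End Equivalences.

(** * Direct sums of Lie modules *)

Section LieDirectSum.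
Variables (K : fieldType) (g : lie_algebra K) (I : choiceType) (X : I -> lie_module g).

Definition dsum_act (x : g) : dprod X -> dprod X := dmap (fun i => @act K g (X i) x).

Lemma dsum_act_linl v : linear (dsum_act^~ v).
Proof.
by move=> c x y; apply: functional_extensionality_dep => i; exact: act_linl.
Qed.

Lemma dsum_act_linr x : linear (dsum_act x).
Proof. exact: dmap_linear. Qed.

Lemma dsum_act_bracket x y v :
  dsum_act (bracket x y) v = dsum_act x (dsum_act y v) - dsum_act y (dsum_act x v).
Proof. by apply: functional_extensionality_dep => i; exact: act_bracket. Qed.

Definition dsum_module : lie_module g :=
  LieModule dsum_act_linl dsum_act_linr dsum_act_bracket.

Lemma dsum_locally_nilpotent (x : g) : fin_supp X ->
    (forall i, locally_nilpotent 0 (@act K g (X i) x)) ->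
  locally_nilpotent 0 (@act K g dsum_module x).
Proof.
move=> /fin_suppP[s us s0] nil f.
have iterE n i : iter n (@act K g dsum_module x) f i = iter n (act x) (f i).
  by elim: n => //= n <-.
have [N NP] : exists N : I -> nat, forall i, iter (N i) (act x) (f i) = 0.
  by have [N NP] := choice (fun i => nil i (f i)); exists N.
(* The support is finite, so one exponent serves all components. *)
exists (\max_(i <- s) N i); apply: functional_extensionality_dep => i.
rewrite iterE dprod0E; have [si|si] := boolP (i \in s); last exact: s0.
rewrite -(subnK (@leq_bigmax_seq _ s xpredT N i si isT)) iterD NP.
by elim: (_ - _)%N => //= n ->; rewrite linear0.
Qed.

Definition dsum_inj i : lie_hom (X i) dsum_module :=
  @linear_lie_hom K g (X i) dsum_module (@dinj K I X i)
    (fun x v => esym (dmap_dinj (fun i => @act K g (X i) x) v)).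

Lemma dsum_lift (N : lie_module g) (h : forall i, lie_hom (X i) N) : fin_supp X ->
  exists u : lie_hom dsum_module N, forall i v, u (dinj v) = h i v.
Proof.
move=> Xfin; have [u uE] := dprod_coproduct (fun i => h i) Xfin.
have u_hom (x : g) (v : dsum_module) : u (act x v) = act x (u v).
  apply: (dprod_ext (u := u \o @act K g dsum_module x) (w := @act K g N x \o u) Xfin) => i w.
  rewrite /= -[X in u X]/(dmap (fun i => @act K g (X i) x) (dinj w)) dmap_dinj !uE.
  exact: lie_hom_act.
by exists (@linear_lie_hom K g dsum_module N u u_hom).
Qed.

End LieDirectSum.

(* The maps below are all identities: they unfold the nested hom spaces one
   category at a time, since asking the kernel to convert the module structure
   of a hom space of a block directly to that of [lie_hom] is very slow. *)
Section HomUnfolding.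
Variable K : fieldType.
Local Notation g := (g_alg K).

Lemma linear_fun0 (U V : lmodType K) (f : U -> V) : linear f -> f 0 = 0.
Proof. by move=> fl; exact: (linear0 (linear_of fl)). Qed.

Lemma linear_comp (U V W : lmodType K) (f : U -> V) (h : V -> W) :
  linear f -> linear h -> linear (fun u => h (f u)).
Proof. by move=> fl hl c u v; rewrite fl hl. Qed.

Definition full_hom (C : category K) (P : C -> Prop) (X Y : full_subcategory P)
  (f : Defs.hom X Y) : Defs.hom (sval X) (sval Y) := f.

Lemma full_hom_linear (C : category K) (P : C -> Prop) (X Y : full_subcategory P) :
  linear (@full_hom C P X Y).
Proof. by []. Qed.

Lemma full_homM (C : category K) (P : C -> Prop) (X Y Z : full_subcategory P)
    (h : Defs.hom Y Z) (f : Defs.hom X Y) :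
  full_hom (Defs.comp h f) = Defs.comp (full_hom h) (full_hom f).
Proof. by []. Qed.

Definition sum_hom_at (I : Type) (C : I -> category K) (X Y : direct_sum_category C) i
  (f : Defs.hom X Y) : Defs.hom (sval X i) (sval Y i) := f i.

Lemma sum_hom_at_linear (I : Type) (C : I -> category K) (X Y : direct_sum_category C) i :
  linear (@sum_hom_at I C X Y i).
Proof. by []. Qed.

Definition cat_lie_hom (M N : lie_module_category g) (f : Defs.hom M N) : @lie_hom K g M N := f.

Lemma cat_lie_hom_linear (M N : lie_module_category g) : linear (@cat_lie_hom M N).
Proof. by []. Qed.

Lemma cat_lie_homM (M N S : lie_module_category g) (h : Defs.hom N S) (f : Defs.hom M N) :
  cat_lie_hom (Defs.comp h f) = lie_comp (cat_lie_hom h) (cat_lie_hom f).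
Proof. by []. Qed.

Definition W0bar_module (M : W0bar K) : lie_module g := sval (sval M).

Definition W0bar_hom (M N : W0bar K) (f : Defs.hom M N) :
    lie_hom (W0bar_module M) (W0bar_module N) := cat_lie_hom (full_hom (full_hom f)).

Lemma W0bar_hom_linear (M N : W0bar K) : linear (@W0bar_hom M N).
Proof.
exact: (linear_comp (@full_hom_linear (W0 K) _ M N)
  (linear_comp (@full_hom_linear (lie_module_category g) _ (sval M) (sval N))
    (@cat_lie_hom_linear _ _))).
Qed.

Lemma W0bar_homM (M N S : W0bar K) (h : Defs.hom N S) (f : Defs.hom M N) :
  W0bar_hom (Defs.comp h f) = lie_comp (W0bar_hom h) (W0bar_hom f).
Proof.
exact: (etrans (congr1 (fun k => @cat_lie_hom _ _ (full_hom k))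
                  (@full_homM (W0 K) _ M N S h f))
  (etrans (congr1 (@cat_lie_hom _ _)
             (@full_homM (lie_module_category g) _ _ _ _ (full_hom h) (full_hom f)))
    (cat_lie_homM _ _))).
Qed.

Lemma W0bar_hom_ext (M N : W0bar K) (f h : Defs.hom M N) :
  (forall v, W0bar_hom f v = W0bar_hom h v) -> f = h.
Proof. exact: lie_hom_ext. Qed.

Definition block_module xi (M : W0bar_block xi) : lie_module g := W0bar_module (sval M).

Definition block_hom xi (M N : W0bar_block xi) (f : Defs.hom M N) :
  lie_hom (block_module M) (block_module N) := W0bar_hom (full_hom f).

Lemma block_hom_linear xi (M N : W0bar_block xi) : linear (@block_hom xi M N).
Proof.
exact: (linear_comp (@full_hom_linear (W0bar K) (in_block xi) M N)
  (@W0bar_hom_linear (sval M) (sval N))).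
Qed.

Lemma block_homM xi (M N S : W0bar_block xi) (h : Defs.hom N S) (f : Defs.hom M N) :
  block_hom (Defs.comp h f) = lie_comp (block_hom h) (block_hom f).
Proof.
exact: (etrans (congr1 (@W0bar_hom _ _) (@full_homM (W0bar K) (in_block xi) M N S h f))
  (W0bar_homM _ _)).
Qed.

Lemma block_hom_ext xi (M N : W0bar_block xi) (f h : Defs.hom M N) :
  (forall v, block_hom f v = block_hom h v) -> f = h.
Proof. exact: W0bar_hom_ext. Qed.

Lemma full_is_iso (C : category K) (P : C -> Prop) (X Y : full_subcategory P)
  (f : Defs.hom X Y) : is_iso (full_hom f) -> is_iso f.
Proof. by []. Qed.

Lemma W0bar_bijective_is_iso (M N : W0bar K) (f : Defs.hom M N) :
  bijective (W0bar_hom f) -> is_iso f.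
Proof.
move=> /bijective_is_iso f_iso; apply: (@full_is_iso (W0 K) _ M N f).
exact: (@full_is_iso (lie_module_category g) _ (sval M) (sval N) f).
Qed.

Lemma block_bijective_is_iso xi (M N : W0bar_block xi) (f : Defs.hom M N) :
  bijective (block_hom f) -> is_iso f.
Proof.
move=> f_bij; apply: (@full_is_iso (W0bar K) (in_block xi) M N f).
exact: (@W0bar_bijective_is_iso (sval M) (sval N) (full_hom f) f_bij).
Qed.

Definition mk_W0bar (M : lie_module g) (nil : locally_nilpotent 0 (@act K g M (@gb K)))
  (fl : finite_length M) : W0bar K := exist _ (exist _ M nil) fl.

(** Translates the finite support of a family of objects into that of the underlying spaces. *)
Lemma zero_obj_block xi (M : W0bar_block xi) :
  zero_obj M <-> forall v : block_module M, v = 0.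
Proof.
have h0 := linear_fun0 (@block_hom_linear xi M M).
split=> [M0 v|M0].
  exact: (congr1 (fun f : lie_hom _ _ => f v) (etrans (congr1 (@block_hom xi M M) M0) h0)).
by apply: block_hom_ext => v; exact: etrans (M0 _) (esym (M0 _)).
Qed.

End HomUnfolding.

HB.instance Definition _ (K : fieldType) := gen_eqMixin (coset K).
HB.instance Definition _ (K : fieldType) := gen_choiceMixin (coset K).

(** * The direct sum functor from the blocks *)

Section BlockDecomposition.
Variable K : closedFieldType.
Local Notation g := (g_alg K).
Local Notation ga := (@ga K).
Local Notation gb := (@gb K).
Local Notation blocks := (fun xi : coset K => W0bar_block xi).
Local Notation dsum_cat := (direct_sum_category blocks).

Lemma coset_disjoint (xi eta : coset K) x : sval xi x -> sval eta x -> xi = eta.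
Proof.
have sub (l m : K) (n n' : int) : l + n%:~R = m + n'%:~R ->
    [set mu | exists k : int, mu = l + k%:~R] `<=` [set mu | exists k : int, mu = m + k%:~R].
  move=> e _ [k ->]; exists (n' - n + k); rewrite intrD intrB addrA.
  by congr (_ + _); rewrite addrA -e addrK.
move=> xix etax; apply: eq_sig_hprop => [? ? ?|]; first exact: Prop_irrelevance.
case: xi eta xix etax => [X [l Xl]] [Y [m Ym]] /=; rewrite {}Xl {}Ym => -[n xn] [n' xn'].
by apply/seteqP; split; [apply: (sub _ _ n n')|apply: (sub _ _ n' n)]; rewrite -xn -xn'.
Qed.

Lemma coset_add1 (xi : coset K) x : sval xi x -> sval xi (x + 1).
Proof.
case: xi => [D [l Dl]] /=; rewrite Dl => -[n ->].
by exists (n + 1); rewrite intrD addrA.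
Qed.

Definition coset_of_elt (x : K) : coset K :=
  exist _ [set mu | exists n : int, mu = x + n%:~R] (ex_intro _ x erefl).

Lemma coset_of_eltP x : sval (coset_of_elt x) x.
Proof. by exists 0; rewrite addr0. Qed.

Lemma block_nil (xi : coset K) (M : W0bar_block xi) :
  locally_nilpotent 0 (@act K g (block_module M) gb).
Proof. exact: svalP (sval (sval M)). Qed.

Lemma block_finite_length (xi : coset K) (M : W0bar_block xi) : finite_length (block_module M).
Proof. exact: svalP (sval M). Qed.

Lemma block_decomposition (xi : coset K) (M : W0bar_block xi) :
  fin_dim (block_module M) /\
  forall v, gspace (@act K g (block_module M) ga) (sval xi) v.
Proof.
have [|Mfd [r rD rM]] := @finite_length_decomposition K (block_module M) (sval xi)
  (block_finite_length M) (@block_nil xi M); first exact: (svalP M).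
by split=> // v; exists r.
Qed.

Definition summands (X : dsum_cat) (xi : coset K) : lie_module g := block_module (sval X xi).

Lemma summands_fin_supp (X : dsum_cat) : fin_supp (summands X).
Proof.
apply: sub_finite_set (svalP X) => xi /= nz /zero_obj_block; exact: nz.
Qed.

Definition sum_module (X : dsum_cat) : lie_module g := dsum_module (summands X).

Lemma sum_nil (X : dsum_cat) : locally_nilpotent 0 (@act K g (sum_module X) gb).
Proof.
apply: dsum_locally_nilpotent (summands_fin_supp X) _ => xi; exact: block_nil.
Qed.

(** Goes through finite dimension, which passes to finitely supported products directly, instead of
    splicing composition series. *)
Lemma sum_finite_length (X : dsum_cat) : finite_length (sum_module X).
Proof.
apply: fin_dim_finite_length _ (@sum_nil X); apply: fin_dim_dprod.
  exact: summands_fin_supp.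
by move=> xi; case: (block_decomposition (sval X xi)).
Qed.

Definition sum_obj (X : dsum_cat) : W0bar K := mk_W0bar (@sum_nil X) (sum_finite_length X).

Definition component (X Y : dsum_cat) (f : Defs.hom X Y) (xi : coset K) :
  lie_hom (summands X xi) (summands Y xi) := block_hom (sum_hom_at xi f).

Lemma component_linear (X Y : dsum_cat) xi : linear (fun f : Defs.hom X Y => component f xi).
Proof.
exact: (linear_comp (@sum_hom_at_linear K _ blocks X Y xi) (@block_hom_linear K xi _ _)).
Qed.

Lemma sum_map_act (X Y : dsum_cat) (f : Defs.hom X Y) (x : g) (v : sum_module X) :
  dmap (fun xi => component f xi) (act x v) =
  @act K g (sum_module Y) x (dmap (fun xi => component f xi) v).
Proof. by apply: functional_extensionality_dep => xi; exact: lie_hom_act. Qed.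

Definition sum_map (X Y : dsum_cat) (f : Defs.hom X Y) : lie_hom (sum_module X) (sum_module Y) :=
  @linear_lie_hom K g (sum_module X) (sum_module Y) (dmap (fun xi => component f xi))
    (sum_map_act f).

Arguments sum_map {X Y} f.

Lemma sum_map_linear X Y :
  linear (@sum_map X Y : Defs.hom X Y -> @Defs.hom K (W0bar K) (sum_obj X) (sum_obj Y)).
Proof.
move=> c f h; apply: W0bar_hom_ext => v; rewrite W0bar_hom_linear.
apply: functional_extensionality_dep => xi.
exact: (congr1 (fun k : lie_hom _ _ => k (v xi)) (component_linear xi c f h)).
Qed.

Lemma sum_map1 X : sum_map (idm X) = @idm K (W0bar K) (sum_obj X).
Proof. by apply: (@W0bar_hom_ext K (sum_obj X) (sum_obj X)) => v; exact: erefl. Qed.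

Lemma sum_mapM X Y Z (h : Defs.hom Y Z) (f : Defs.hom X Y) :
  sum_map (Defs.comp h f) =
  @Defs.comp K (W0bar K) (sum_obj X) (sum_obj Y) (sum_obj Z) (sum_map h) (sum_map f).
Proof.
apply: (@W0bar_hom_ext K (sum_obj X) (sum_obj Z)) => v.
apply: functional_extensionality_dep => xi.
exact: (congr1 (fun k : lie_hom _ _ => k (v xi)) (block_homM (sum_hom_at xi h) (sum_hom_at xi f))).
Qed.

Definition sum_functor : functor dsum_cat (W0bar K) :=
  Functor sum_map_linear sum_map1 sum_mapM.

Definition sum_inj (X : dsum_cat) xi : @Defs.hom K (W0bar K) (sval (sval X xi)) (sum_obj X) :=
  dsum_inj (summands X) xi.

Lemma sum_inj_natural (X Y : dsum_cat) (f : Defs.hom X Y) xi :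
  Defs.comp (fmap sum_functor f) (sum_inj X xi) =
  Defs.comp (sum_inj Y xi) (full_hom (sum_hom_at xi f)).
Proof.
apply: (@W0bar_hom_ext K (sval (sval X xi)) (sum_obj Y)) => v.
apply: etrans (congr1 (fun k : lie_hom _ _ => k v) (@W0bar_homM K _ _ _ _ _)) _.
apply: etrans (esym (congr1 (fun k : lie_hom _ _ => k v) (@W0bar_homM K _ _ _ _ _))).
exact: (dmap_dinj (fun xi => component f xi)).
Qed.

Lemma sum_inj_coproduct (X : dsum_cat) (Y : W0bar K)
    (h : forall xi, @Defs.hom K (W0bar K) (sval (sval X xi)) Y) :
  exists! u : Defs.hom (sum_functor X) Y, forall xi, Defs.comp u (sum_inj X xi) = h xi.
Proof.
have [u uE] := dsum_lift (fun xi => W0bar_hom (h xi)) (summands_fin_supp X).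
exists u; split.
  move=> xi; apply: (@W0bar_hom_ext K (sval (sval X xi)) Y) => v.
  by apply: etrans (congr1 (fun k : lie_hom _ _ => k v) (@W0bar_homM K _ _ _ _ _)) _; exact: uE.
move=> u' u'E; apply: (@W0bar_hom_ext K (sum_obj X) Y) => v.
apply: (dprod_ext (u := u : {linear sum_module X -> W0bar_module Y})
  (w := W0bar_hom u' : {linear sum_module X -> W0bar_module Y}) (summands_fin_supp X)) => xi w.
apply: etrans (uE xi w) _.
apply: etrans (congr1 (fun k : lie_hom _ _ => k w) (@W0bar_homM K _ _ _ u' (sum_inj X xi))).
exact: (congr1 (fun k => W0bar_hom k w) (esym (u'E xi))).
Qed.

Lemma sum_functor_direct_sum : is_direct_sum_functor sum_functor.
Proof. exists sum_inj; split; [exact: sum_inj_natural|exact: sum_inj_coproduct]. Qed.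

(** The inverse keeps the diagonal entries of a morphism; [dprod_hom_diag], graded by the cosets,
    shows that nothing is lost. *)
Lemma sum_functor_ff X Y : bijective (@fmap K dsum_cat (W0bar K) sum_functor X Y).
Proof.
pose diag_fun (f : lie_hom (sum_module X) (sum_module Y)) xi (v : summands X xi) :
    summands Y xi := f (dinj v) xi.
have diag_lin f xi : linear (diag_fun f xi).
  by move=> c u v; rewrite /diag_fun linearP lie_hom_linear.
have diag_act f xi (x : g) v :
    linear_of (diag_lin f xi) (act x v) = act x (linear_of (diag_lin f xi) v).
  rewrite /= /diag_fun -(dmap_dinj (fun i => @act K g (summands X i) x)).
  exact: (congr1 (fun w : sum_module Y => w xi) (lie_hom_act f x (dinj v))).
pose inv (f : lie_hom (sum_module X) (sum_module Y)) : Defs.hom X Y :=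
  fun xi => linear_lie_hom (diag_act f xi).
exists inv => f.
  apply: functional_extensionality_dep => xi; apply: block_hom_ext => v.
  exact: (congr1 (component f xi) (dinj_eq (V := summands X) v)).
apply: (@W0bar_hom_ext K (sum_obj X) (sum_obj Y)) => v.
apply: functional_extensionality_dep => xi; apply/esym.
pose fl : lie_hom (sum_module X) (sum_module Y) := f.
have fl_diag := @dprod_hom_diag K (coset K) (fun xi => sval xi) (@coset_disjoint)
  (summands X) (summands Y) (fun i => @act K g (summands X i) ga)
  (fun i => @act K g (summands Y i) ga)
  (@linear_of K (dprod (summands X)) (dprod (summands Y)) fl (lie_hom_linear fl)).
apply: (fl_diag _ _ _ _ v xi).
- exact: summands_fin_supp.
- by move=> i w; case: (block_decomposition (sval X i)).
- by move=> i w; case: (block_decomposition (sval Y i)).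
- by move=> w; exact: (lie_hom_act fl ga w).
Qed.

(** The component at a coset is the sum of the generalized eigenspaces of [a] for its elements. It
    is stable under [b], which raises eigenvalues by one, because a coset is closed under adding
    1. *)
Lemma sum_functor_es (M : W0bar K) :
  exists (X : dsum_cat) (e : Defs.hom (sum_functor X) M), is_iso e.
Proof.
case: M => [[M nil] fl]; have [Mfd [r rM]] := finite_length_fin_dim fl nil.
have sub_xi (xi : coset K) : {N : lie_module g & {i : lie_hom N M |
    [/\ fin_dim N, injective i &
        forall v, gspace (@act K g M ga) (sval xi) v <-> exists w, i w = v]}}.
  have [|N /cid[i iP]] := cid (@submodule_coordinates K M
      [set v | gspace (@act K g M ga) (sval xi) v] Mfd _); last by exists N, i.
  apply: ab_submodule => [|c u v|v|v]; [exact: gspace0|exact: gspace_lin|exact: gspace_morph|].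
  move=> /= vxi; apply: (gspace_raise (D := sval xi) (B := @act K g M gb)) vxi => [u|x].
    exact: act_a_b.
  exact: coset_add1.
pose N xi := projT1 (sub_xi xi).
pose i xi : lie_hom (N xi) M := sval (projT2 (sub_xi xi)).
have Nfd xi : fin_dim (N xi) by case: (svalP (projT2 (sub_xi xi))).
have iI xi : injective (i xi) by case: (svalP (projT2 (sub_xi xi))).
have iE xi v : gspace (@act K g M ga) (sval xi) v <-> exists w, i xi w = v.
  by case: (svalP (projT2 (sub_xi xi))).
have Nnil xi : locally_nilpotent 0 (@act K g (N xi) gb).
  exact: (locally_nilpotent_lie_inj (iI xi) nil).
have Nxi xi (v : N xi) : gspace (@act K g (N xi) ga) (sval xi) v.
  apply: (gspace_morph_inj (iI xi) (T' := @act K g M ga)) => [u|]; first exact: lie_hom_act.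
  by apply/iE; exists v.
pose B xi : W0bar_block xi := exist _
  (mk_W0bar (Nnil xi) (fin_dim_finite_length (Nfd xi) (Nnil xi)))
  (simple_subquotient_gspace (Nnil xi) (Nxi xi)).
have Bfin : finitely_supported B.
  (* Only the cosets of the entries of the annihilating list [r] can have a nonzero component. *)
  apply: (@sub_finite_set _ _ (coset_of_elt @` [set` r])); last exact/finite_image/finite_seq.
  move=> xi /= /zero_obj_block/existsNP[v v0].
  apply: contrapT => xi_r; apply: v0; apply: (iI xi); rewrite linear0.
  apply: (gspace_disjoint (T := @act K g M ga) (D := sval xi) (E := [set` r])) => [x xix xr||].
  - by apply: xi_r; exists x => //; apply: coset_disjoint xix; exact: coset_of_eltP.
  - by apply/iE; exists v.
  - by exists r.
have Nfin : fin_supp N.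
  by apply: sub_finite_set Bfin => xi /= nz /zero_obj_block; exact: nz.
have [u uE] := dsum_lift i Nfin.
have u_bij : bijective u.
  have bij := @gspace_dlift_bij K (coset K) (fun xi => sval xi) (@coset_disjoint) M
    (@act K g M ga) N (fun xi => i xi)
    (@linear_of K (dprod N) M u (lie_hom_linear u)) Nfin iI iE _ uE.
  apply: bij => w; exists r => // x _.
  exists (coset_of_elt x); exact: coset_of_eltP.
set X : dsum_cat := exist _ B Bfin.
exists X, u; exact: (@W0bar_bijective_is_iso K (sum_obj X) (exist _ (exist _ M nil) fl) u u_bij).
Qed.

Lemma sum_functor_equivalence : is_equivalence sum_functor.
Proof. exact: fully_faithful_equivalence sum_functor_ff sum_functor_es. Qed.

End BlockDecomposition.

(** * Blocks and quiver representations *)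

Section QuiverToBlock.
Variables (K : closedFieldType) (lam : K).
Hypothesis intr_eq0 : forall n : int, n%:~R = 0 :> K -> n = 0.
Local Notation g := (g_alg K).
Local Notation ga := (@ga K).
Local Notation gb := (@gb K).
Implicit Types V W : qrep K.

Definition weight (i : int) : set K := [set lam + i%:~R].

(** Characteristic zero, in the form of [intr_eq0], keeps the weights of distinct vertices apart. *)
Lemma weight_disjoint i j x : weight i x -> weight j x -> i = j.
Proof.
move=> -> /addrI ij; apply/eqP; rewrite -subr_eq0; apply/eqP/intr_eq0.
by rewrite intrB ij subrr.
Qed.

Definition qtotal V : lmodType K := dprod (fun i => qspace V i : lmodType K).

(** The action of [a] at a vertex: the loop is its nilpotent part, [lam + i] its eigenvalue. *)
Definition qweight V i (v : qspace V i) : qspace V i := (lam + i%:~R) *: v + qa V i v.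

Lemma qweight_linear V i : linear (@qweight V i).
Proof.
by move=> c u v; rewrite /qweight (linearP (qa V i)) !scalerDr !scalerA !(mulrC c) addrACA.
Qed.

HB.instance Definition _ V i :=
  GRing.isLinear.Build K (qspace V i) (qspace V i) _ _ (@qweight_linear V i).

(** The action of [b]. The arrow out of [j - 1] ends in the space at [j - 1 + 1], hence the
    transport; every vertex is a successor, so [qshiftS] and [qtotal_extS] allow reasoning without
    it. *)
Definition qshift V (f : qtotal V) : qtotal V := fun j =>
  eq_rect (j - 1 + 1) (fun k => qspace V k : Type) (qb V (j - 1) (f (j - 1))) j (subrK 1 j).

Lemma qshiftS V (f : qtotal V) i : qshift f (i + 1) = qb V i (f i).
Proof.
rewrite /qshift; move: (i + 1 - 1) (subrK _ _) => k e.
have ki : k = i by exact: addIr e.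
by subst k; rewrite (eq_axiomK e).
Qed.

Lemma qtotal_extS V (f h : qtotal V) : (forall i, f (i + 1) = h (i + 1)) -> f = h.
Proof.
by move=> fh; apply: functional_extensionality_dep => j; have := fh (j - 1); rewrite subrK.
Qed.

Lemma qshift_linear V : linear (@qshift V).
Proof.
by move=> c u v; apply: qtotal_extS => i; rewrite dprodDE dprodZE !qshiftS linearP.
Qed.

HB.instance Definition _ V :=
  GRing.isLinear.Build K (qtotal V) (qtotal V) _ _ (@qshift_linear V).

Lemma qshift_dinj V i (v : qspace V i) :
  qshift (dinj (V := fun i => qspace V i : lmodType K) v) =
  dinj (V := fun i => qspace V i : lmodType K) (qb V i v).
Proof.
apply: qtotal_extS => j; rewrite qshiftS; have [<-|ij] := pselect (i = j).
  by rewrite !dinj_eq.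
by rewrite !dinj_neq ?linear0 // => /addIr.
Qed.

Definition qdiag V : {linear qtotal V -> qtotal V} :=
  dmap (V := fun i => qspace V i : lmodType K) (W := fun i => qspace V i : lmodType K)
    (fun i => @qweight V i).

Lemma qdiag_dinj V i (v : qspace V i) :
  qdiag V (dinj (V := fun i => qspace V i : lmodType K) v) =
  dinj (V := fun i => qspace V i : lmodType K) (qweight v).
Proof. exact: (dmap_dinj (fun i => @qweight V i)). Qed.

Lemma qrelE V i v : qb V i (qa V i v) = qa V (i + 1) (qb V i v).
Proof. by have /lfunP/(_ v) := qrel V i; rewrite !lfunE. Qed.

(** Loops commute with arrows by the quiver relation; the extra [qshift f] is the difference between
    the eigenvalues at [i + 1] and at [i]. *)
Lemma qdiag_shift V f : qdiag V (qshift f) = qshift (qdiag V f) + qshift f.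
Proof.
apply: qtotal_extS => i; rewrite dprodDE !qshiftS /= /dmap /qweight qshiftS.
by rewrite linearD linearZ /= qrelE intrD addrA scalerDl scale1r addrAC.
Qed.

Definition qmodule V : lie_module g := ab_module (@qdiag_shift V).

Lemma qspace_fin_supp V : fin_supp (fun i => qspace V i : lmodType K).
Proof.
apply: sub_finite_set (@qfin K V) => i /= nz; apply/eqP => d0; apply: nz => v.
have : v \in (fullv : {vspace qspace V i}) by exact: memvf.
by have /eqP := d0; rewrite dimv_eq0 => /eqP ->; rewrite memv0 => /eqP.
Qed.

Lemma qmodule_fin_dim V : fin_dim (qmodule V).
Proof.
apply: fin_dim_dprod; first exact: qspace_fin_supp.
by move=> i; exact: fin_dim_vect.
Qed.

Lemma iter_qshift V (f : qtotal V) n j : f (j - n%:Z) = 0 -> iter n (@qshift V) f j = 0.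
Proof.
elim: n j => [|n IH] j; first by rewrite subr0.
move=> fj; suff : iter n.+1 (@qshift V) f (j - 1 + 1) = 0 by rewrite subrK.
rewrite iterS qshiftS IH ?linear0 //.
by have -> : j - 1 - n%:Z = j - n.+1%:Z by lia.
Qed.

Lemma qmodule_nil V : locally_nilpotent 0 (@act K g (qmodule V) gb).
Proof.
move=> f.
have iterE n : iter n (@act K g (qmodule V) gb) f = iter n (@qshift V) f.
  by elim: n => //= n ->; exact: (@ab_module_b _ _ _ _ (@qdiag_shift V)).
have [s _ s0] := fin_suppP (qspace_fin_supp V).
pose m := (\max_(i <- s) `|i|)%N.
(* The support lies between [-m] and [m], so a shift by more than [2m] leaves it. *)
exists (m + m).+1; rewrite iterE; apply: functional_extensionality_dep => j.
have [js|js] := boolP (j \in s); last exact: s0.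
apply: iter_qshift; apply: s0; apply/negP => js'.
have jm := @leq_bigmax_seq _ s xpredT (fun i : int => `|i|%N) j js isT.
have jm' := @leq_bigmax_seq _ s xpredT (fun i : int => `|i|%N) _ js' isT.
by move: jm jm'; rewrite -/m; lia.
Qed.

Lemma qmodule_finite_length V : finite_length (qmodule V).
Proof. exact: fin_dim_finite_length (qmodule_fin_dim V) (@qmodule_nil V). Qed.

Lemma qspace_gspace V i v : gspace (@qweight V i) (weight i) v.
Proof.
(* Subtracting [lam + i] from the action of [a] leaves the loop, and [n] of these kill [v]. *)
have [n nv] := qnil v; exists (nseq n (lam + i%:~R)) => [x|].
  by rewrite mem_nseq => /andP[_ /eqP].
rewrite -[RHS]nv; elim: n {nv} => //= n ->.
by rewrite /qweight addrAC subrr add0r.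
Qed.

Variable xi : coset K.
Hypothesis xiE : sval xi = [set mu | exists n : int, mu = lam + n%:~R].

Lemma weight_xi i : weight i `<=` sval xi.
Proof. by move=> _ ->; rewrite xiE; exists i. Qed.

Lemma qmodule_gspace V (v : qmodule V) : gspace (@act K g (qmodule V) ga) (sval xi) v.
Proof.
have := gspace_dprod (qspace_fin_supp V) weight_xi (@qspace_gspace V) v.
apply: (gspace_morph (f := idfun : {linear qmodule V -> qmodule V})) => w.
exact/esym/ab_module_a.
Qed.

Lemma qmodule_in_block V : in_block xi (mk_W0bar (@qmodule_nil V) (qmodule_finite_length V)).
Proof. exact: simple_subquotient_gspace (@qmodule_nil V) (@qmodule_gspace V). Qed.

Definition qblock V : W0bar_block xi := exist _ _ (@qmodule_in_block V).

Definition qmap_fun V W (f : qhom V W) : {linear qmodule V -> qmodule W} :=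
  dmap (V := fun i => qspace V i : lmodType K) (W := fun i => qspace W i : lmodType K)
    (fun i => f i : {linear _ -> _}).

Lemma qmap_act V W (f : qhom V W) (x : g) (v : qmodule V) :
  qmap_fun f (act x v) = act x (qmap_fun f v).
Proof.
apply: ab_lie_hom => {}v.
  rewrite !ab_module_a; apply: functional_extensionality_dep => i.
  rewrite /= /dmap /qweight linearD linearZ /=; congr (_ + _).
  by have /lfunP/(_ (v i)) := qhom_a f i; rewrite !lfunE.
rewrite !ab_module_b; apply: qtotal_extS => i; rewrite [RHS]qshiftS.
change (f (i + 1) (qshift v (i + 1)) = qb W i (f i (v i))); rewrite qshiftS.
by have /lfunP/(_ (v i)) := qhom_b f i; rewrite !lfunE.
Qed.

Definition qmap V W (f : qhom V W) : lie_hom (qmodule V) (qmodule W) :=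
  linear_lie_hom (qmap_act f).

Lemma qmap_linear V W :
  linear (@qmap V W : @Defs.hom K (qrep_category K) V W -> Defs.hom (qblock V) (qblock W)).
Proof.
move=> c f h; apply: (@block_hom_ext K xi (qblock V) (qblock W)) => v.
rewrite (@block_hom_linear K xi (qblock V) (qblock W)).
apply: functional_extensionality_dep => i.
by rewrite /= /dmap add_lfunE scale_lfunE.
Qed.

Lemma qmap1 V : qmap (qid V) = @idm K (W0bar_block xi) (qblock V).
Proof.
apply: lie_hom_ext => v; apply: functional_extensionality_dep => i.
by rewrite /= /dmap id_lfunE.
Qed.

Lemma qmapM U V W (h : qhom V W) (f : qhom U V) :
  qmap (qcomp h f) =
  @Defs.comp K (W0bar_block xi) (qblock U) (qblock V) (qblock W) (qmap h) (qmap f).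
Proof.
apply: lie_hom_ext => v; apply: functional_extensionality_dep => i.
by rewrite /= /dmap comp_lfunE.
Qed.

Definition qfunctor : functor (qrep_category K) (W0bar_block xi) :=
  @Functor K (qrep_category K) (W0bar_block xi) qblock qmap qmap_linear qmap1 qmapM.

Local Notation lsp V := (fun i => qspace V i : lmodType K).

(** As for the blocks, but graded by single eigenvalues: [dprod_hom_diag] makes every module
    morphism diagonal over the vertices. *)
Lemma qfunctor_ff V W : bijective (@fmap K (qrep_category K) (W0bar_block xi) qfunctor V W).
Proof.
pose diag_fun (f : lie_hom (qmodule V) (qmodule W)) i (v : V i) : W i :=
  f (dinj (V := lsp V) v) i.
have diag_lin f i : linear (diag_fun f i).
  by move=> c u v; rewrite /diag_fun linearP lie_hom_linear.
pose diag f i : 'Hom(V i, W i) := linfun (linear_of (diag_lin f i)).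
have diagE f i v : diag f i v = f (dinj (V := lsp V) v) i by rewrite lfunE.
have fdiag (f : lie_hom (qmodule V) (qmodule W)) (v : qmodule V) i :
    f v i = f (dinj (V := lsp V) (v i)) i.
  have fl_diag := @dprod_hom_diag K int weight weight_disjoint (lsp V) (lsp W)
    (fun i => @qweight V i) (fun i => @qweight W i)
    (@linear_of K (qtotal V) (qtotal W) f (lie_hom_linear f)).
  apply: fl_diag => [|||w]; [exact: qspace_fin_supp|exact: qspace_gspace|exact: qspace_gspace|].
  have /= := lie_hom_act f ga w.
  by rewrite -[ab_act _ _ _ w]/(@act K g (qmodule V) ga w) ab_module_a
    -[ab_act _ _ _ _]/(@act K g (qmodule W) ga (f w)) ab_module_a.
have diag_hom f : (diag f : dprod (fun i => 'Hom(V i, W i) : lmodType K)) \in @qhom_pred K V W.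
  apply/asboolP; split=> i; apply/lfunP => v; rewrite !comp_lfunE !diagE.
    have := congr1 (fun w : qtotal W => w i) (lie_hom_act f ga (dinj (V := lsp V) v)).
    rewrite !ab_module_a qdiag_dinj => h.
    (* Cancelling the scalar part of [a] leaves compatibility with the loops. *)
    apply: (addrI ((lam + i%:~R) *: f (dinj (V := lsp V) v) i)).
    exact: etrans (esym (diag_lin f i _ v (qa V i v))) h.
  have := congr1 (fun w : qtotal W => w (i + 1)) (lie_hom_act f gb (dinj (V := lsp V) v)).
  by rewrite !ab_module_b /= qshift_dinj qshiftS.
exists (fun f => QHom (diag_hom f)) => f.
  apply: qhom_ext => i; apply/lfunP => v.
  by rewrite [LHS]diagE /= /dmap dinj_eq.
apply: (@block_hom_ext K xi (qblock V) (qblock W)) => v.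
apply: functional_extensionality_dep => i; apply: etrans (diagE _ _ _) _.
exact/esym/fdiag.
Qed.

(** Coordinates replace each generalized eigenspace by a row space, since a representation consists
    of [vectType]s; the restrictions of [a - (lam + i)] and [b] are carried over through the
    injections [phi i]. *)
Lemma qfunctor_es (M : W0bar_block xi) :
  exists (V : qrep_category K) (e : Defs.hom (qfunctor V) M), is_iso e.
Proof.
pose Mm := block_module M; pose T : {linear Mm -> Mm} := @act K g Mm ga.
have [Mfd [r rxi rM]] := @finite_length_decomposition K Mm (sval xi)
  (block_finite_length M) (@block_nil K xi M) (svalP M).
have coord i : {n : nat & {phi : {linear 'rV[K]_n -> Mm} |
    injective phi /\ forall v, gspace T (weight i) v <-> exists x, phi x = v}}.
  have [|n /cid[phi phiP]] := cid (@subspace_coordinates K Mm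
      [set v | gspace T (weight i) v] Mfd (gspace0 _ _) _); last by exists n, phi.
  by move=> c u v; exact: gspace_lin.
pose n i := projT1 (coord i).
pose phi i : {linear 'rV[K]_(n i) -> Mm} := sval (projT2 (coord i)).
have phiI i : injective (phi i) by case: (svalP (projT2 (coord i))).
have phiE i v : gspace T (weight i) v <-> exists x, phi i x = v.
  by case: (svalP (projT2 (coord i))).
have phi_in i x : gspace T (weight i) (phi i x) by apply/phiE; exists x.
have exA i : exists a : 'End('rV[K]_(n i)),
    forall x, phi i (a x) = shifts T [:: lam + i%:~R] (phi i x).
  have [|a aP] := @factor_through K Mm _ _ (phi i) (shifts T [:: lam + i%:~R] \o phi i) (phiI i).
    move=> x; apply/phiE => /=; rewrite addrC -scaleNr.
    apply: gspace_lin => //; exact: gspace_morph.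
  by exists (linfun a) => x; rewrite lfunE aP.
have exB i : exists b : 'Hom('rV[K]_(n i), 'rV[K]_(n (i + 1))),
    forall x, phi (i + 1) (b x) = act gb (phi i x).
  have [|b bP] := @factor_through K Mm _ _ (phi (i + 1)) (@act K g Mm gb \o phi i) (phiI (i + 1)).
    move=> x; apply/phiE; apply: (gspace_raise (D := weight i)) (phi_in i x) => [v|y ->].
      exact: act_a_b.
    by rewrite /weight /= intrD addrA.
  by exists (linfun b) => x; rewrite lfunE bP.
have [a aP] : {a : forall i, 'End('rV[K]_(n i)) |
    forall i x, phi i (a i x) = shifts T [:: lam + i%:~R] (phi i x)}.
  by exists (fun i => sval (cid (exA i))) => i; exact: svalP (cid (exA i)).
have [b bP] : {b : forall i, 'Hom('rV[K]_(n i), 'rV[K]_(n (i + 1))) |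
    forall i x, phi (i + 1) (b i x) = act gb (phi i x)}.
  by exists (fun i => sval (cid (exB i))) => i; exact: svalP (cid (exB i)).
have rel i : (b i \o a i = a (i + 1) \o b i)%VF.
  apply/lfunP => x; rewrite !comp_lfunE; apply: (phiI (i + 1)).
  rewrite bP !aP !bP /= linearB linearZ /= intrD addrA [(_ + 1) *: _]scalerDl scale1r opprD addrA.
  by rewrite act_a_b [RHS]addrAC addrK.
have fin : finite_set [set i : int | \dim (fullv : {vspace 'rV[K]_(n i)}) != 0%N].
  (* A nonzero space at [i] forces [lam + i] into the finite list [r], and distinct vertices have
     distinct weights. *)
  apply: (@sub_finite_set _ _ ((fun i : int => lam + i%:~R) @^-1` [set` r])).
    move=> i /= d0; apply: contrapT => ir; move/eqP: d0; apply; apply/eqP.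
    rewrite dimv_eq0 -subv0; apply/subvP => x _; rewrite memv0; apply/eqP.
    apply: (phiI i); rewrite linear0.
    apply: (gspace_disjoint (T := T) (D := weight i) (E := [set` r])) (phi_in i x) _.
      by move=> y ->; exact: ir.
    by exists r.
  apply: finite_preimage; last exact: finite_seq.
  by move=> i j _ _ ij; apply: (weight_disjoint (x := lam + i%:~R)).
have nil i : locally_nilpotent 0 (a i).
  (* All entries of [s] equal [lam + i], so the product is the power of the loop with exponent
     [size s]. *)
  move=> x; have [s sw sx] := phi_in i x; exists (size s); apply: (phiI i).
  rewrite linear0 -sx; elim: s sw {sx} => //= y s IH sw.
  rewrite aP /= IH; last by move=> z zs; apply: sw; rewrite inE zs orbT.
  by rewrite (sw y) // mem_head.
pose V : qrep K := QRep rel fin nil.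
have [u uE] := @dprod_coproduct K int (lsp V) Mm phi (qspace_fin_supp V).
have u_a (v : qmodule V) : u (act ga v) = act ga (u v).
  rewrite ab_module_a.
  apply: (@dprod_ext K int (lsp V) Mm (u \o qdiag V) (@act K g Mm ga \o u)
    (qspace_fin_supp V)) => i w /=.
  by rewrite (@qdiag_dinj V i w) !uE /qweight linearD linearZ /= aP /= addrC subrK.
have u_b (v : qmodule V) : u (act gb v) = act gb (u v).
  rewrite ab_module_b.
  apply: (@dprod_ext K int (lsp V) Mm (u \o @qshift V) (@act K g Mm gb \o u)
    (qspace_fin_supp V)) => i w /=.
  by rewrite (@qshift_dinj V i w) !uE bP.
pose e : lie_hom (qmodule V) Mm := @linear_lie_hom K g (qmodule V) Mm u (ab_lie_hom u_a u_b).
have e_bij : bijective e.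
  have bij := @gspace_dlift_bij K int weight weight_disjoint Mm T (lsp V) phi u
    (qspace_fin_supp V) phiI phiE _ uE.
  apply: bij => w; exists r => // x /rxi; rewrite xiE => -[i ->].
  by exists i.
exists V, e; exact: (@block_bijective_is_iso K xi (qblock V) M e e_bij).
Qed.

Lemma block_equivalent_qrep : equivalent (W0bar_block xi) (qrep_category K).
Proof.
apply: (@is_equivalence_equivalent K _ _ qfunctor).
by apply: fully_faithful_equivalence; [exact: qfunctor_ff|exact: qfunctor_es].
Qed.

End QuiverToBlock.

Theorem theorem52 (R : realType) :
  (exists F : functor (direct_sum_category (fun xi : coset R[i] => W0bar_block xi))
                      (W0bar R[i]),
     is_direct_sum_functor F /\ is_equivalence F) /\
  (forall xi : coset R[i],
     equivalent (W0bar_block xi) (qrep_category R[i])).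
Proof.
split.
  exists (sum_functor R[i]); split; first exact: sum_functor_direct_sum.
  exact: sum_functor_equivalence.
(* Any representative [lam] of the coset serves as the eigenvalue at vertex 0. *)
move=> xi; have [lam xiE] := svalP xi.
apply: (@block_equivalent_qrep R[i] lam _ xi xiE) => n /eqP.
by rewrite intr_eq0 => /eqP.
Qed.
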